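(* Let $p$ be a prime, let $k\geq 3$ be an integer, let $0<\varepsilon<1$ and set $\delta=\varepsilon^{C_{p,k}}$. Then for every $n\geq 1$ and any sets $X_1,\dots,X_k\subseteq \mathbb{F}_p^{n}$, at least one of the following holds: (a) the number of $k$-cycles $(x_1,\dots,x_k)\in X_1\times\dots\times X_k$ is at least $\delta N^{k-1}$; or (b) one can delete fewer than $\varepsilon N$ elements from each of the sets $X_1,\dots,X_k$ so that afterwards no $k$-cycles remain in $X_1\times\dots\times X_k$.
   Context: Let $p$ be a fixed prime, $n\geq 1$, and $N=p^n=|\mathbb{F}_p^n|$. For sets $X_1,\dots,X_k\subseteq\mathbb{F}_p^n$, a $k$-cycle is a $k$-tuple $(x_1,\dots,x_k)\in X_1\times\dots\times X_k$ with $x_1+\dots+x_k=0$. Define the constant $0<c_{p,3}<1$ by $\inf_{0<t<1}\frac{t^0+t^1+\dots+t^{p-1}}{t^{(p-1)/3}}=p^{1-c_{p,3}}$, set $C_{p,3}=1+\frac{1}{c_{p,3}}$, and for $k\geq 3$ set $C_{p,k}=(k-2)(C_{p,3}-1)+1=\frac{k-2}{c_{p,3}}+1$. *)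

(* Defs.v *)
From HB Require Import structures.
From mathcomp Require Import all_boot all_order all_algebra.
From Stdlib Require Import Reals.

Set Implicit Arguments.
Unset Strict Implicit.
Unset Printing Implicit Defensive.

Section Cyc.
Local Open Scope ring_scope.
Definition cycles (p n k : nat) (X : 'I_k -> {set 'rV['F_p]_n})
  : {set {ffun 'I_k -> 'rV['F_p]_n}} :=
  [set x : {ffun 'I_k -> 'rV['F_p]_n} |
     [forall i, x i \in X i] && (\sum_(i < k) x i == 0)].

Definition num_cycles (p n k : nat) (X : 'I_k -> {set 'rV['F_p]_n}) : nat :=
  #|cycles X|.
End Cyc.

Local Open Scope R_scope.

Definition gfun (p : nat) (t : R) : R :=
  sum_f_R0 (fun i => t ^ i) (p - 1)%nat / Rpower t ((INR p - 1) / 3).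

(* c is the constant c_{p,3}: inf_{0<t<1} g_p(t) = p^(1-c). *)
Definition is_c_p3 (p : nat) (c : R) : Prop :=
  (forall t, 0 < t < 1 -> Rpower (INR p) (1 - c) <= gfun p t) /\
  (forall e, 0 < e -> exists t, 0 < t < 1 /\ gfun p t < Rpower (INR p) (1 - c) + e).

Definition C_pk (c : R) (k : nat) : R := INR (k - 2) / c + 1.

(* Main.v *)
Require Import Defs.
From HB Require Import structures.
From Stdlib Require Import Reals Lra.
From mathcomp Require Import all_boot all_order all_algebra.
From mathcomp Require Import finfield Rstruct zify.

Set Implicit Arguments.
Unset Strict Implicit.
Unset Printing Implicit Defensive.

(* Take a maximal family of m cycles that are pairwise disjoint in every
   coordinate.  If m < eps N, deleting its elements leaves no cycle, so it is
   enough to show that any such family forces at least m d^(k-2) cycles, where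
   d = N (m/N)^(1/c).  Both sides are multiplicative under taking powers of the
   whole configuration, so a loss polynomial in n is harmless.
   Up to such a loss one may assume that every x in X_j lies in at most T/m of
   the T cycles and, by pigeonhole, that for each J the partial sum s_J of a
   typical cycle has about A_J representations as a sum over J and about A_{J^c}
   as minus a sum over J^c; so s_J takes about n_J = T/(A_J A_{J^c}) values.
   Counting cycles through s_I, s_P, s_Q yields
   n_{I u P} n_{I u Q} >= n_I n_{I u P u Q} up to the loss, and hence a chain
   from {a} to {b}^c, adding one index at a time, on which n_J >= m.  For each
   step, the triples (s_I, x_a, s_{I u a}) are restricted to a random affine copy
   of a space F_p^r in which a constant proportion of them is isolated.  The
   slice rank bound for tricolored sum-free sets then gives A_{I^c} >= d A_{(I u a)^c},
   and these inequalities telescope to T/m >= A_{a^c} >= d^(k-2). *)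

(** * Tricolored sum-free sets *)

(** Regularity controls [n_J] directly only for singletons and their complements, where one of the
    two representation counts is at most 1. For the index sets in between only the cross inequality
    is available, so the chain has to be found adaptively. A single step would be a plain slice rank
    estimate if the three degrees of the system of triples were comparable. They are not: the degree
    at s_I is to be bounded from below, while the degrees at x_a and s_{I u a} may be far larger,
    since only n_J >= m is known. Thinning the first coordinate of the sampled space to a subset
    compensates for this, and makes the unknown number of triples cancel. The dyadic pigeonholing
    runs over all 2^k index sets at once; it costs a power of n whose exponent depends only on k,
    which the passage to powers can absorb. *)

Section SliceRank.
Import GRing.Theory.
Local Open Scope ring_scope.

(** A basis of the left kernel has an invertible minor of full size; some combination of the basis
    is therefore 1 on all the coordinates of that minor. *)
Lemma exists_ones_in_left_kernel (F : fieldType) (L r : nat) (H : 'M[F]_(L, r)) :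
  exists (e : nat) (w : 'rV[F]_L) (f : 'I_e -> 'I_L),
    [/\ (L <= e + r)%N, injective f, w *m H = 0 & forall i, w 0 (f i) = 1].
Proof.
pose K := kermx H; pose B := row_base K.
have fB : row_full B^T by rewrite /row_full mxrank_tr; exact: row_base_free.
pose f := fullrankfun fB.
pose S := rowsub f B^T.
have Su : S \in unitmx by rewrite -row_full_unit; exact: fullrowsub_full.
exists (\rank K), ((invmx S *m const_mx 1)^T *m B), f; split.
- rewrite mxrank_ker; have := rank_leq_col H; lia.
- exact: fullrankfun_inj.
- rewrite -mulmxA; suff -> : B *m H = 0 by rewrite mulmx0.
  by apply/eqP; rewrite -sub_kermx eq_row_base.
- move=> i; set v := invmx S *m const_mx 1 : 'cV[F]_(\rank K).
  have : (S *m v) i 0 = 1 by rewrite mulKVmx // mxE.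
  rewrite !mxE => <-; apply: eq_bigr => j _.
  by rewrite !mxE mulrC.
Qed.

(** The slice rank of a diagonal tensor. Contracting the third index with a vector [w] that
    annihilates every [h s] kills the third sum. On the [e] indices where [w] is 1 it leaves the
    identity matrix, written with [2 * #|A|] terms of rank at most 1. *)
Lemma slice_rank_diag (F : fieldType) (I S : finType) (E : {set I}) (A : {set S})
    (f g h : S -> I -> F) (f' g' h' : S -> I -> I -> F) :
  (forall i j l, i \in E -> j \in E -> l \in E ->
    ((i == j) && (j == l))%:R =
      \sum_(s in A) f s i * f' s j l + \sum_(s in A) g s j * g' s i l
      + \sum_(s in A) h s l * h' s i j) ->
  (#|E| <= 3 * #|A|)%N.
Proof.
move=> D.
have [e [w [t [leL injt w0 w1]]]] :=
  exists_ones_in_left_kernel (\matrix_(i < #|E|, s < #|A|) h (enum_val s) (enum_val i)).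
suff : (e <= 2 * #|A|)%N by lia.
pose a (i : 'I_#|E|) : I := enum_val i.
pose F1 := \matrix_(i < e, s < #|A|) f (enum_val s) (a (t i)).
pose F2 := \matrix_(s < #|A|, j < e) \sum_l w 0 l * f' (enum_val s) (a (t j)) (a l).
pose G1 := \matrix_(j < e, s < #|A|) g (enum_val s) (a (t j)).
pose G2 := \matrix_(s < #|A|, i < e) \sum_l w 0 l * g' (enum_val s) (a (t i)) (a l).
have eq1 : 1%:M = F1 *m F2 + (G1 *m G2)^T.
  apply/matrixP => i j; rewrite !mxE.
  transitivity (\sum_l w 0 l * ((a (t i) == a (t j)) && (a (t j) == a l))%:R).
    rewrite (bigD1 (t j)) //= w1 eqxx andbT mul1r big1 ?addr0.
      by rewrite (inj_eq enum_val_inj) (inj_eq injt).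
    by move=> l ne; rewrite (inj_eq enum_val_inj (t j)) [t j == l]eq_sym (negPf ne) andbF mulr0.
  transitivity (\sum_l w 0 l * (\sum_(s in A) f s (a (t i)) * f' s (a (t j)) (a l)
      + \sum_(s in A) g s (a (t j)) * g' s (a (t i)) (a l)) +
      \sum_(s in A) (\sum_l w 0 l * h s (a l)) * h' s (a (t i)) (a (t j))).
    under [X in _ = _ + X]eq_bigr do rewrite mulr_suml.
    rewrite exchange_big -big_split /=; apply: eq_bigr => l _.
    rewrite (D _ _ _ (enum_valP _) (enum_valP _) (enum_valP _)) mulrDr; congr (_ + _).
    by rewrite mulr_sumr; apply: eq_bigr => s _; rewrite mulrA.
  rewrite [X in _ + X]big1 ?addr0; last first.
    move=> s sA; suff -> : \sum_l w 0 l * h s (a l) = 0 by rewrite mul0r.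
    move/rowP: w0 => /(_ (enum_rank_in sA s)); rewrite !mxE => w0.
    rewrite -[RHS]w0; apply: eq_bigr => l _.
    by rewrite mxE enum_rankK_in.
  under eq_bigr do rewrite mulrDr.
  rewrite big_split /=; congr (_ + _).
    under eq_bigr do rewrite mulr_sumr.
    rewrite exchange_big /= big_enum_val; apply: eq_bigr => s _.
    rewrite !mxE mulr_sumr; apply: eq_bigr => l _; by rewrite mulrCA.
  under eq_bigr do rewrite mulr_sumr.
  rewrite exchange_big /= big_enum_val; apply: eq_bigr => s _.
  rewrite !mxE mulr_sumr; apply: eq_bigr => l _; by rewrite mulrCA.
have := mxrank1 F e; rewrite eq1 => <-.
apply: leq_trans (mxrank_add _ _) _; rewrite mxrank_tr mulSn mul1n.
by apply: leq_add; apply: leq_trans (mxrankM_maxl _ _) (rank_leq_col _).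
Qed.

End SliceRank.

Section Tricolored.
Import GRing.Theory.
Local Open Scope ring_scope.

Definition low_monomials (p n : nat) : {set {ffun 'I_n -> 'I_p}} :=
  [set e : {ffun 'I_n -> 'I_p} | (3 * (\sum_c e c) <= p.-1 * n)%N].

(** By Fermat, the indicator of $u = 0$ is $1 - u^{p-1}$; this is expanded at $u = a + b + c$. *)
Lemma indicator0_expand (p : nat) : prime p ->
  exists2 q : 'I_p * 'I_p * 'I_p -> 'F_p,
    forall t, q t != 0 -> (t.1.1 + t.1.2 + t.2 <= p.-1)%N &
    forall a b c : 'F_p, (a + b + c == 0)%:R =
      \sum_t q t * (a ^+ t.1.1 * b ^+ t.1.2 * c ^+ t.2).
Proof.
move=> pr_p; have fermat (x : 'F_p) : (x == 0)%:R = 1 - x ^+ p.-1.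
  have [->|x0] := eqVneq x 0.
    by rewrite expr0n; have := prime_gt1 pr_p; case: p.-1 (ltn_predK (prime_gt1 pr_p)) => [<-//|n _ _]; rewrite subr0.
  apply/esym/eqP; rewrite subr_eq0 eq_sym; apply/eqP; apply: (mulfI x0).
  by have := expf_card x; rewrite card_Fp // -exprS prednK ?prime_gt0 // mulr1.
case: p pr_p fermat => // n pr_p fermat.
(* Here [n] is $p - 1$. [q0] gives the constant 1 and [q1] the multinomial coefficients, as products
   of two binomials because the binomial formula is applied twice. *)
pose q0 (t : 'I_n.+1 * 'I_n.+1 * 'I_n.+1) : 'F_n.+1 := (t.1.1 + t.1.2 + t.2 == 0)%N%:R.
pose q1 (t : 'I_n.+1 * 'I_n.+1 * 'I_n.+1) : 'F_n.+1 :=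
   (t.1.1 + t.1.2 + t.2 == n)%N%:R *+ 'C(n - t.2, t.1.2) *+ 'C(n, t.2).
exists (fun t => q0 t - q1 t).
  move=> t; apply: contraNT; rewrite -ltnNge /= => lt_n.
  rewrite /q0 /q1; set s := (_ + _ + _)%N in lt_n *.
  by rewrite (gtn_eqF lt_n) !mul0rn subr0 (gtn_eqF (leq_ltn_trans _ lt_n)).
move=> a b c; rewrite fermat; under eq_bigr do rewrite mulrBl.
rewrite sumrB; congr (_ - _).
  rewrite (bigD1 (ord0, ord0, ord0)) //= /q0 /= !mulr1 big1 ?addr0 //.
  move=> [[i j] l] /= ne; case: eqP => [e|_]; last by rewrite mul0r.
  case/negP: ne; rewrite !xpair_eqE -!val_eqE /=; lia.
rewrite exprDn /=.
rewrite -(pair_big xpredT xpredT (fun ij l => q1 (ij, l) * (a ^+ ij.1 * b ^+ ij.2 * c ^+ l))) /=.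
rewrite exchange_big /=; apply: eq_bigr => l _.
rewrite exprDn mulr_suml -sumrMnl.
rewrite -(pair_big xpredT xpredT (fun i j => q1 (i, j, l) * (a ^+ i * b ^+ j * c ^+ l))) /=.
rewrite exchange_big /=.
have -> : \sum_(j < n.+1) \sum_(i < n.+1) q1 (i, j, l) * (a ^+ i * b ^+ j * c ^+ l) =
  \sum_(j < n.+1 | (j <= n - l)%N) \sum_(i < n.+1) q1 (i, j, l) * (a ^+ i * b ^+ j * c ^+ l).
  rewrite [LHS](bigID (fun j : 'I_n.+1 => (j <= n - l)%N)) /= [X in _ + X]big1 ?addr0 //.
  move=> j; rewrite -ltnNge => lt_j; apply: big1 => i _.
  by rewrite /q1 /= bin_small // mulr0n mul0rn mul0r.
have lel : ((n - l).+1 <= n.+1)%N by rewrite ltnS leq_subr.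
rewrite (big_ord_widen_cond _ xpredT (fun j => (a ^+ (n - l - j) * b ^+ j *+ 'C(n - l, j) * c ^+ l) *+ 'C(n, l)) lel) /=.
apply: eq_big => [j|j lej]; first by rewrite ltnS.
have ltn : (n - l - j < n.+1)%N by lia.
rewrite (bigD1 (Ordinal ltn)) //= big1 ?addr0.
  rewrite /q1 /=; have -> : (n - l - j + j + l)%N = n by have := ltn_ord l; lia.
  by rewrite eqxx !mulrnAl mul1r.
move=> i; rewrite -val_eqE /= => ne; rewrite /q1 /=.
case: eqP => [e|_]; first by case/negP: ne; apply/eqP; lia.
by rewrite !mul0rn mul0r.
Qed.

(* Expanding the indicator of x.1 + y.2 - z.1 - z.2 = 0 as a polynomial of degree
   (p - 1) n, every monomial has degree at most a third of that in one of the
   three groups of variables. *)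
Lemma tricolored_sum_free (p n : nat) (E : {set 'rV['F_p]_n * 'rV['F_p]_n}) :
  prime p ->
  (forall x y z, x \in E -> y \in E -> z \in E ->
     x.1 + y.2 = z.1 + z.2 -> x = y /\ y = z) ->
  (#|E| <= 3 * #|low_monomials p n|)%N.
Proof.
move=> pr_p free; have [q q_deg qE] := indicator0_expand pr_p.
pose mono (u : 'rV['F_p]_n) (e : {ffun 'I_n -> 'I_p}) := \prod_c u 0 c ^+ e c.
pose T3 := ('I_p * 'I_p * 'I_p)%type.
pose e1 (s : {ffun 'I_n -> T3}) := [ffun c => (s c).1.1].
pose e2 (s : {ffun 'I_n -> T3}) := [ffun c => (s c).1.2].
pose e3 (s : {ffun 'I_n -> T3}) := [ffun c => (s c).2].
pose Q (s : {ffun 'I_n -> T3}) := \prod_c q (s c).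
pose z (x : 'rV['F_p]_n * 'rV['F_p]_n) := - (x.1 + x.2).
pose low s := s \in low_monomials p n.
(* Each monomial is assigned to the first of the three variables in which its degree is low, so that
   none is counted twice. *)
apply: (@slice_rank_diag 'F_p _ _ E (low_monomials p n)
  (fun e x => mono x.1 e) (fun e x => mono x.2 e) (fun e x => mono (z x) e)
  (fun e y t => \sum_(s | low (e1 s) && (e1 s == e)) Q s * (mono y.2 (e2 s) * mono (z t) (e3 s)))
  (fun e x t => \sum_(s | (~~ low (e1 s) && low (e2 s)) && (e2 s == e))
     Q s * (mono x.1 (e1 s) * mono (z t) (e3 s)))
  (fun e x y => \sum_(s | (~~ low (e1 s) && ~~ low (e2 s) && low (e3 s)) && (e3 s == e))
     Q s * (mono x.1 (e1 s) * mono y.2 (e2 s)))) => x y t xE yE tE.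
have -> : ((x == y) && (y == t)) = (x.1 + y.2 + z t == 0).
  rewrite subr_eq0; apply/andP/eqP => [[/eqP-> /eqP->]//|/(free _ _ _ xE yE tE)[-> ->]].
  by rewrite eqxx.
transitivity (\prod_c (x.1 0 c + y.2 0 c + z t 0 c == 0)%:R : 'F_p).
  have [e|/eqP ne] := eqP.
    rewrite big1 // => c _; move/rowP: e => /(_ c); rewrite !mxE => ->.
    by rewrite eqxx.
  have /existsP[c nc] : [exists c, x.1 0 c + y.2 0 c + z t 0 c != 0].
    apply: contraNT ne => /existsPn h; apply/eqP/rowP => c.
    by move/negPn/eqP: (h c); rewrite !mxE.
  by rewrite (bigD1 c) //= (negPf nc) mul0r.
under eq_bigr do rewrite qE.
rewrite bigA_distr_bigA /=.
pose G (s : {ffun 'I_n -> T3}) := Q s * (mono x.1 (e1 s) * mono y.2 (e2 s) * mono (z t) (e3 s)).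
transitivity (\sum_s G s).
  apply: eq_bigr => s _; rewrite /G /Q /mono -!big_split /=.
  by apply: eq_bigr => c _; rewrite !ffunE.
rewrite (bigID (fun s => low (e1 s))) /= -addrA; congr (_ + _).
  rewrite (partition_big e1 (mem (low_monomials p n))) //=.
  apply: eq_bigr => e _; rewrite mulr_sumr; apply: eq_bigr => s /andP[_ /eqP<-].
  by rewrite /G -mulrA mulrCA.
rewrite (bigID (fun s => low (e2 s))) /=; congr (_ + _).
  rewrite (partition_big e2 (mem (low_monomials p n))); last by move=> s /andP[].
  apply: eq_bigr => e _; rewrite mulr_sumr; apply: eq_bigr => s /andP[_ /eqP<-].
  by rewrite /G [mono x.1 _ * _]mulrC -mulrA mulrCA.
rewrite (bigID (fun s => low (e3 s))) /= [X in _ + X]big1 ?addr0.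
  rewrite (partition_big e3 (mem (low_monomials p n))); last by move=> s /andP[].
  apply: eq_bigr => e _; rewrite mulr_sumr; apply: eq_bigr => s /andP[_ /eqP<-].
  by rewrite /G mulrA mulrC.
move=> s /andP[/andP[n1 n2] n3]; rewrite /G.
suff -> : Q s = 0 by rewrite mul0r.
apply/eqP; apply: contraNT n3 => /prodf_neq0 nz.
have deg : (\sum_c e1 s c + \sum_c e2 s c + \sum_c e3 s c <= p.-1 * n)%N.
  rewrite -!big_split /= -[n in (_ * n)%N]card_ord mulnC -sum_nat_const.
  by apply: leq_sum => c _; rewrite !ffunE; exact/q_deg/nz.
move: n1 n2 deg; rewrite /low !inE -!ltnNge.
move: (\sum_c e1 s c)%N (\sum_c e2 s c)%N (\sum_c e3 s c)%N (p.-1 * n)%N => a b d m; lia.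
Qed.

End Tricolored.

(** * The exponent c_{p,3} *)

Section Exponent.
Local Open Scope R_scope.

(** Markov's inequality for the weight $t^{\deg}$: a low monomial weighs at least $t^{(p-1)n/3}$
    because $t < 1$, and the weights of all monomials sum to the [n]-th power of the geometric
    sum. *)
Lemma sum_low_monomials_le (p n : nat) (t : R) : (0 < p)%N -> 0 < t < 1 ->
  INR #|low_monomials p n| * Rpower t ((INR p - 1) / 3 * INR n)
    <= sum_f_R0 (fun i => t ^ i) (p - 1) ^ n.
Proof.
move=> p_gt0 [t0 t1].
set S := sum_f_R0 _ _; pose w (e : {ffun 'I_n -> 'I_p}) := t ^ (\sum_c e c)%N.
have -> : S ^ n = (\sum_(e : {ffun 'I_n -> 'I_p}) w e)%R.
  have -> : S = (\sum_(i < p) pow t i)%R by rewrite /S sum_f_R0E subn1 prednK // big_mkord.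
  rewrite RpowE -[n in LHS]card_ord -GRing.prodr_const.
  rewrite [LHS]bigA_distr_bigA; apply: eq_bigr => e _.
  rewrite /w RpowE GRing.expr_sum; apply: eq_bigr => c _; exact: RpowE.
apply: (Rle_trans _ (\sum_(e in low_monomials p n) w e)%R); last first.
  apply/RleP; rewrite [X in (_ <= X)%R](bigID (fun e => e \in low_monomials p n)) /= Num.Theory.lerDl.
  by apply: Num.Theory.sumr_ge0 => e _; apply/RleP/pow_le; lra.
apply/RleP; rewrite INRE RmultE GRing.mulr_natl -GRing.sumr_const.
apply: Num.Theory.ler_sum => e; rewrite inE => le_e; apply/RleP.
rewrite /w -Rpower_pow //.
have ln_t : ln t < 0 by rewrite -ln_1; apply: ln_increasing.
rewrite /Rpower.
have : INR (3 * (\sum_c e c)) <= INR (p.-1 * n) by apply/le_INR/leP.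
rewrite !mult_INR -subn1 minus_INR; last exact/leP.
set s := INR (\sum_c e c) => /= le_s.
case: (Rle_lt_or_eq_dec ((INR p - 1) / 3 * INR n * ln t) (s * ln t)).
- nra.
- by move=> lt; left; apply: exp_increasing.
- by move=> ->; right.
Qed.

Lemma card_low_monomials_gfun (p n : nat) (t : R) : (0 < p)%N -> 0 < t < 1 ->
  INR #|low_monomials p n| <= gfun p t ^ n.
Proof.
move=> p_gt0 t01; have := sum_low_monomials_le n p_gt0 t01.
have q0 := exp_pos ((INR p - 1) / 3 * INR n * ln t).
rewrite /gfun /Rdiv Rpow_mult_distr pow_inv -(Rpower_pow n (Rpower _ _)); last exact: exp_pos.
rewrite Rpower_mult => le.
apply: (Rmult_le_reg_r _ _ _ q0); rewrite -/(Rpower _ _).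
rewrite Rmult_assoc Rinv_l ?Rmult_1_r //; exact: Rgt_not_eq.
Qed.

(** The infimum defining [c] need not be attained. If the count exceeded the bound, continuity of
    [y ^ n] would make it exceed [gfun p t ^ n] for some [t] as well. *)
Lemma card_low_monomials (p n : nat) (c : R) : (0 < p)%N -> is_c_p3 p c ->
  INR #|low_monomials p n| <= Rpower (INR p) (1 - c) ^ n.
Proof.
move=> p_gt0 [_ inf_c]; set B := Rpower _ _; set x := INR _.
have B0 : 0 < B by exact: exp_pos.
case: (Rle_lt_dec x (B ^ n)) => // lt_x; exfalso.
have cont : continuity_pt (fun y => y ^ n) B.
  exact/derivable_continuous_pt/derivable_pt_pow.
have [e [e0 near]] := cont (x - B ^ n) ltac:(lra).
have [t [t01 lt_t]] := inf_c (e / 2) ltac:(lra).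
have x_le := card_low_monomials_gfun n p_gt0 t01; rewrite -/x in x_le.
have g_le : gfun p t ^ n <= (B + e / 2) ^ n.
  apply: pow_incr; split; last by rewrite /B; lra.
  rewrite /gfun; apply: Rmult_le_pos.
    by apply: cond_pos_sum => i; apply: pow_le; lra.
  by left; apply/Rinv_0_lt_compat/exp_pos.
have := near (B + e / 2); rewrite /dist /= /Rdist => near'.
have : Rabs ((B + e / 2) ^ n - B ^ n) < x - B ^ n.
  apply: near'; split; first by split => //; lra.
  by rewrite Rabs_pos_eq; lra.
by move=> /(Rle_lt_trans _ _ _ (Rle_abs _)); lra.
Qed.

Lemma gfun_ge1 (p : nat) (t : R) : (0 < p)%N -> 0 < t < 1 -> 1 <= gfun p t.
Proof.
move=> p_gt0 t01; have q0 : 0 < Rpower t ((INR p - 1) / 3) by exact: exp_pos.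
have q_le1 : Rpower t ((INR p - 1) / 3) <= 1.
  rewrite /Rpower; apply: (Rle_trans _ (exp 0)); last by rewrite exp_0; lra.
  have ln_t : ln t < 0 by rewrite -ln_1; apply: ln_increasing; lra.
  have p1 : 1 <= INR p by apply: (le_INR 1); apply/leP.
  case: (Rle_lt_or_eq_dec ((INR p - 1) / 3 * ln t) 0); first nra.
    by move=> /exp_increasing; lra.
  by move=> ->; lra.
have S_ge1 : 1 <= sum_f_R0 (fun i => t ^ i) (p - 1).
  elim: (p - 1)%N => /= [|n IH]; first lra.
  have := pow_le t n ltac:(lra); nra.
rewrite /gfun; set q := Rpower t _ in q0 q_le1 *; set S := sum_f_R0 _ _ in S_ge1 *.
apply: (Rmult_le_reg_r _ _ _ q0).
have -> : S / q * q = S by field; lra.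
lra.
Qed.

Lemma c_p3_le1 (p : nat) (c : R) : prime p -> is_c_p3 p c -> c <= 1.
Proof.
move=> pr_p [_ inf_c]; case: (Rle_lt_dec c 1) => // c1; exfalso.
have p1 : 1 < INR p by apply: (lt_INR 1); apply/ltP/prime_gt1.
have lt1 : Rpower (INR p) (1 - c) < 1.
  apply: (Rlt_le_trans _ (Rpower (INR p) 0)); first by apply: Rpower_lt; lra.
  by rewrite Rpower_O; lra.
have [t [t01 lt_t]] := inf_c (1 - Rpower (INR p) (1 - c)) ltac:(lra).
by have := gfun_ge1 (prime_gt0 pr_p) t01; lra.
Qed.

(** By Bernoulli the term of index $i$ is at most $1/(1+3ih)$, hence at most $1 - 21ih/10$ as $3ih
    \le 3/10$. Averaging over $i$ halves the slope to 21/20; that this still exceeds 1 is what makes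
    [c] positive. *)
Lemma geometric_sum_upper (q : nat) (h : R) : 0 < h -> 10 * INR q * h <= 1 ->
  forall m, (m <= q)%N ->
  sum_f_R0 (fun i => ((1 - h) ^ 3) ^ i) m
    <= (INR m + 1) * (1 - 21 / 20 * h * INR m).
Proof.
move=> h0 qh; elim=> [|m IH] lem; first by rewrite /=; lra.
rewrite tech5 S_INR; have {IH} := IH (ltnW lem).
have mq : INR m + 1 <= INR q by rewrite -S_INR; apply/le_INR/leP.
have m0 := pos_INR m.
suff : ((1 - h) ^ 3) ^ m.+1 <= 1 - 21 / 10 * h * (INR m + 1).
  cbv beta; lra.
have h1 : h <= 1 / 10 by nra.
rewrite -pow_mult; set i := (3 * m.+1)%coq_nat.
have -> : INR m + 1 = INR i / 3 by rewrite /i mult_INR (S_INR m) (_ : INR 3 = 3); [lra | rewrite /=; lra].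
have bern : 1 + INR i * h <= (1 + h) ^ i by exact: Rfunctions.poly.
have le1 : (1 - h) ^ i * (1 + h) ^ i <= 1.
  rewrite -Rpow_mult_distr -[X in _ <= X](pow1 i); apply: pow_incr; nra.
have i0 : 0 <= INR i * h by have := pos_INR i; nra.
have ih : INR i * h <= 3 / 10.
  have : INR i <= 3 * INR q by rewrite /i mult_INR (S_INR m) (_ : INR 3 = 3); [lra | rewrite /=; lra].
  nra.
have z0 : 0 <= (1 - h) ^ i by apply: pow_le; lra.
have le2 : (1 - h) ^ i * (1 + INR i * h) <= 1 by nra.
set z := (1 - h) ^ i in z0 le2 *; set y := INR i * h in i0 ih le2.
have -> : 21 / 10 * h * (INR i / 3) = 7 / 10 * y by rewrite /y; lra.
nra.
Qed.

(** At $t = 1$ the logarithmic derivative of [gfun p] is the mean exponent $(p-1)/2$ minus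
    $(p-1)/3$, which is positive; so [gfun p] drops below its value $p$ just left of 1. The choice
    $t = (1-h)^3$ turns the denominator into $(1-h)^{p-1}$. *)
Lemma c_p3_gt0 (p : nat) (c : R) : prime p -> is_c_p3 p c -> 0 < c.
Proof.
move=> pr_p [lb _].
have p2 : 2 <= INR p by apply: (le_INR 2); apply/leP/prime_gt1.
pose q := INR p - 1; pose h := / (10 * q).
have q1 : 1 <= q by rewrite /q; lra.
have qh : 10 * q * h = 1 by rewrite /h; field; lra.
have h0 : 0 < h by apply: Rinv_0_lt_compat; lra.
have h1 : h <= 1 / 10 by nra.
have Eq : INR (p - 1) = q by rewrite minus_INR //; apply/leP/prime_gt0.
have t01 : 0 < (1 - h) ^ 3 < 1 by simpl; nra.
have := lb _ t01.
have -> : gfun p ((1 - h) ^ 3) = sum_f_R0 (fun i => ((1 - h) ^ 3) ^ i) (p - 1) / (1 - h) ^ (p - 1).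
  rewrite /gfun; congr (_ / _).
  rewrite -Rpower_pow -?Rpower_pow; try lra.
  rewrite Rpower_mult; congr Rpower; rewrite Eq /= /q; lra.
have up := @geometric_sum_upper (p - 1) h h0 ltac:(rewrite Eq; lra) (p - 1)%N (leqnn _).
rewrite Eq in up.
have bern : 1 - q * h <= (1 - h) ^ (p - 1).
  rewrite -Eq; elim: (p - 1)%N => [|n IH]; first by rewrite /=; lra.
  rewrite S_INR /=; have := pos_INR n; nra.
set S := sum_f_R0 _ _ in up *; set d := (1 - h) ^ _ in bern *.
move=> le; have d0 : 0 < d by nra.
have lt : S / d < INR p.
  apply: (Rmult_lt_reg_r _ _ _ d0); rewrite /Rdiv Rmult_assoc Rinv_l; last lra.
  have -> : INR p = q + 1 by rewrite /q; lra.
  nra.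
case: (Rlt_le_dec 0 c) => // c0; exfalso.
have : INR p <= Rpower (INR p) (1 - c).
  apply: (Rle_trans _ (Rpower (INR p) 1)); first by rewrite Rpower_1; lra.
  apply: Rle_Rpower; lra.
lra.
Qed.

End Exponent.

(** * Random restriction of triangles *)

Section Sampling.
Import GRing.Theory.
Local Open Scope ring_scope.

Variables (p n r : nat).
Hypothesis pr_p : prime p.
Local Notation V := 'rV['F_p]_n.
Local Notation W := 'rV['F_p]_r.
Local Notation M := 'M['F_p]_(r, n).

Lemma card_rV m : #|{: 'rV['F_p]_m}| = (p ^ m)%N.
Proof. by rewrite card_mx card_Fp // mul1n. Qed.

Lemma card_mulmx_preim (w : W) (B : {set V}) : w != 0 ->
  (#|[set A : M | w *m A \in B]| * p ^ n = #|B| * #|{: M}|)%N.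
Proof.
move=> w0; pose c0 := #|[set A : M | w *m A == 0]|.
have fib y : #|[set A : M | w *m A == y]| = c0.
  have [i wi] : exists i, w 0 i != 0 by apply/rV0Pn.
  pose A0 : M := (w 0 i)^-1 *: (delta_mx i 0 *m y).
  have wA0 : w *m A0 = y.
    apply/rowP => j; rewrite !mxE (bigD1 i) //= big1 ?addr0.
      rewrite !mxE big_ord_recl big_ord0 !mxE !eqxx mul1r addr0.
      by rewrite mulrA mulfV // mul1r.
    move=> l ne; rewrite !mxE big_ord_recl big_ord0 !mxE (negPf ne) /=.
    by rewrite mul0r addr0 !mulr0.
  rewrite /c0 -[RHS](card_imset _ (@addrI _ A0)); apply: eq_card => A; rewrite inE.
  apply/idP/imsetP => [/eqP wA|[A' + ->]].
    exists (A - A0); last by rewrite addrC subrK.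
    by rewrite inE mulmxBr wA wA0 subrr.
  by rewrite inE => /eqP wA'; rewrite mulmxDr wA0 wA' addr0 eqxx.
have card_pre (C : {set V}) : #|[set A : M | w *m A \in C]| = (#|C| * c0)%N.
  rewrite -sum1_card (partition_big (fun A => w *m A) (mem C)) /=; last by move=> A; rewrite inE.
  rewrite -sum_nat_const; apply: eq_bigr => y yC; rewrite -(fib y) -sum1_card.
  apply: eq_bigl => A; rewrite !inE; case: eqP => [->|]; last by rewrite andbF.
  by rewrite yC.
rewrite card_pre -mulnA; congr (_ * _)%N.
have <- : #|[set A : M | w *m A \in [set: V]]| = #|{: M}|.
  by rewrite -cardsT; apply: eq_card => A; rewrite !inE.
by rewrite card_pre cardsT card_rV mulnC.
Qed.

Variable T : {set V * V}.

(* The parameter o = (A, (a, b)) encodes the affine maps u |-> u A + a and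
   v |-> v A + b on the first two coordinates. *)
Definition sample (o : M * (V * V)) (e : W * W) : V * V :=
  (e.1 *m o.1 + o.2.1, e.2 *m o.1 + o.2.2).

Lemma card_sample (e : W * W) :
  #|[set o | sample o e \in T]| = (#|{: M}| * #|T|)%N.
Proof.
rewrite -sum1_card (partition_big fst xpredT) //= -sum_nat_const.
apply: eq_bigr => A _; rewrite -sum1_card.
rewrite (reindex_onto (fun g : V * V => (A, (g.1 - e.1 *m A, g.2 - e.2 *m A))) (fun o => sample o e)).
  apply: eq_bigl => -[x y]; rewrite !inE /sample /= ![_ *m _ + _]addrC !subrK.
  by rewrite !eqxx !andbT.
move=> [A' [a b]]; rewrite inE => /andP[_ /eqP /= ->]; rewrite /sample /=.
by rewrite ![_ *m _ + _]addrC !addrK.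
Qed.

(* Two samples that differ by w != 0 are independent given the first one, since
   w A is uniformly distributed. *)
Lemma card_sample_pair (al be : 'F_p) (D : nat) (e : W * W) (w : W) : w != 0 ->
  (forall g, g \in T -> #|[set y | (g.1 + al *: y, g.2 + be *: y)%R \in T]| <= D)%N ->
  (p ^ n * #|[set o | (sample o e \in T)
                      && (sample o (e.1 + al *: w, e.2 + be *: w)%R \in T)]|
     <= #|{: M}| * #|T| * D)%N.
Proof.
move=> w0 deg.
have -> : #|[set o | (sample o e \in T)
                      && (sample o (e.1 + al *: w, e.2 + be *: w) \in T)]| =
  (\sum_(g in T) #|[set A : M | (w *m A) \in [set y | (g.1 + al *: y, g.2 + be *: y)%R \in T]]|)%N.
  rewrite -sum1_card (partition_big (fun o => sample o e) (mem T)) /=; last first.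
    by move=> o; rewrite inE => /andP[].
  apply: eq_bigr => -[x y] gT; rewrite -sum1_card.
  rewrite (reindex_onto (fun A : M => (A, (x - e.1 *m A, y - e.2 *m A))) fst) /=; last first.
    move=> [A [a b]]; rewrite /sample /= => /andP[_ /eqP[<- <-]].
    by rewrite ![_ *m _ + _]addrC !addrK.
  apply: eq_bigl => A; rewrite !in_set.
  have shift (u v : W) (z : V) : (u + v) *m A + (z - u *m A) = z + v *m A.
    by rewrite mulmxDl addrC addrA subrK.
  have sh0 (u : W) (z : V) : u *m A + (z - u *m A) = z by rewrite addrC subrK.
  by rewrite /sample /= !shift !sh0 -!scalemxAl gT !eqxx !andbT.
rewrite mulnC big_distrl /=.
rewrite (eq_bigr (fun g : V * V => (#|[set y | (g.1 + al *: y, g.2 + be *: y)%R \in T]| * #|{: M}|)%N)); last first.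
  by move=> g _; rewrite card_mulmx_preim.
rewrite [leqRHS](_ : _ = \sum_(g in T) D * #|{: M}|)%N; last first.
  by rewrite sum_nat_const [(D * _)%N]mulnC mulnCA mulnA.
by apply: leq_sum => g gT; rewrite leq_mul2r deg ?orbT.
Qed.

End Sampling.

(** A first moment computation: [s0] counts isolated samples, [s1], [s2], [s3] three kinds of
    collisions. The factors 6 bound each kind by a sixth of all samples, so at least half of the
    samples are isolated. *)
Lemma restriction_count (N P u m t s0 s1 s2 s3 D1 D2 D3 L : nat) :
  0 < N -> 0 < m -> 6 * P * D1 <= N -> 6 * u * D2 <= N -> 6 * u * D3 <= N ->
  N * s1 <= u * P * P * (m * t * D1) -> N * s2 <= u * P * u * (m * t * D2) ->
  N * s3 <= u * P * u * (m * t * D3) -> s0 <= m * N ^ 2 * L ->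
  u * P * (m * t) <= s0 + (s1 + s2 + s3) -> t * (u * P) <= 2 * N ^ 2 * L.
Proof.
move=> N0 m0 le1 le2 le3 b1 b2 b3 b0 tot; set q := u * P * (m * t).
have bound Q D s : 6 * Q * D <= N -> N * s <= u * P * Q * (m * t * D) -> 6 * s <= q.
  move=> le b; rewrite -(leq_pmul2l N0).
  apply: leq_trans (_ : q * (6 * Q * D) <= _); last by rewrite mulnC leq_mul2r le orbT.
  have -> : q * (6 * Q * D) = 6 * (u * P * Q * (m * t * D)) by rewrite /q; lia.
  by rewrite mulnCA leq_mul2l b orbT.
have c1 := bound _ _ _ le1 b1; have c2 := bound _ _ _ le2 b2; have c3 := bound _ _ _ le3 b3.
rewrite -(leq_pmul2l m0).
have -> : m * (t * (u * P)) = q by rewrite /q; lia.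
have -> : m * (2 * N ^ 2 * L) = 2 * (m * N ^ 2 * L) by lia.
by move: tot; rewrite -/q; lia.
Qed.

Section RandomRestriction.
Import GRing.Theory.
Local Open Scope ring_scope.

Variables (p n r : nat).
Hypothesis pr_p : prime p.
Local Notation V := 'rV['F_p]_n.
Local Notation W := 'rV['F_p]_r.
Local Notation M := 'M['F_p]_(r, n).
Variables (X Y Z : {set V}) (U : {set W}).

(* A triple (x, y, x + y) in X * Y * Z is represented by the pair (x, y). *)
Definition triangles : {set V * V} :=
  [set g | [&& g.1 \in X, g.2 \in Y & g.1 + g.2 \in Z]].

Definition sampled (o : M * (V * V)) : {set W * W} :=
  [set e | (e.1 \in U) && (sample o e \in triangles)].

Definition meet (e f : W * W) :=
  [|| f.1 == e.1, f.2 == e.2 | f.1 + f.2 == e.1 + e.2].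

Definition isolated (o : M * (V * V)) : {set W * W} :=
  [set e in sampled o | [forall f in sampled o, meet e f ==> (f == e)]].

(** Used with [(al, be)] equal to (0, 1), (1, 0) and (1, -1), the displacements that preserve the
    first coordinate, the second one and the sum. *)
Definition neighbours (al be : 'F_p) (o : M * (V * V)) (e : W * W) : nat :=
  \sum_(w : W | ((w != 0) && (e.1 + al *: w \in U))%R)
    ((sample o e \in triangles)
     && (sample o (e.1 + al *: w, e.2 + be *: w)%R \in triangles)).

(** If [x.1 + y.2 = z.1 + z.2], then [(x.1, y.2)] is sampled too, because sampling is affine. It
    meets each of [x], [y] and [z], so isolation makes all of them equal. *)
Lemma card_isolated o : (#|isolated o| <= 3 * #|low_monomials p r|)%N.
Proof.
apply: tricolored_sum_free => // x y z.
rewrite !inE => /andP[/andP[xU]] /and3P[xX _ _] /forall_inP isox.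
move=> /andP[/andP[_]] /and3P[_ yY _] /forall_inP isoy.
move=> /andP[/andP[_]] /and3P[_ _ zZ] /forall_inP isoz eq_sum.
have h : (x.1, y.2) \in sampled o.
  rewrite !inE xU xX yY /sample /= addrACA -mulmxDl eq_sum mulmxDl.
  by rewrite -addrACA.
have /implyP/(_ _)/eqP <- := isox _ h; last by rewrite /meet eqxx.
have /implyP/(_ _)/eqP <- := isoy _ h; last by rewrite /meet eqxx orbT.
have /implyP/(_ _)/eqP <- // := isoz _ h.
by rewrite /meet eq_sum eqxx !orbT.
Qed.

Lemma card_sampled_le o :
  (#|sampled o| <= #|isolated o| + \sum_(e | e.1 \in U)
     (neighbours 0%R 1%R o e + neighbours 1%R 0%R o e + neighbours 1%R (-1)%R o e))%N.
Proof.
have -> : #|isolated o| = (\sum_(e | e.1 \in U) (e \in isolated o))%N.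
  rewrite -sum1_card [RHS]big_mkcond [LHS]big_mkcond; apply: eq_bigr => e _.
  by rewrite !inE; case: (e.1 \in U) => //=; case: ifP.
have -> : #|sampled o| = (\sum_(e | e.1 \in U) (e \in sampled o))%N.
  rewrite -sum1_card [RHS]big_mkcond [LHS]big_mkcond; apply: eq_bigr => e _.
  by rewrite !inE; case: (e.1 \in U) => //=; case: ifP.
rewrite -big_split /=; apply: leq_sum => e eU.
case: (boolP (e \in sampled o)) => // eS.
case: (boolP (e \in isolated o)) => // neI.
have or_pos (a b d : nat) : [|| 0 < a, 0 < b | 0 < d]%N -> (0 < a + b + d)%N by lia.
rewrite add0n; apply: or_pos; apply/or3P.
move: neI; rewrite inE eS /= => /forall_inPn[f fS]; rewrite negb_imply => /andP[mt ne].
have eT : sample o e \in triangles by move: eS; rewrite inE => /andP[].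
have fT : sample o f \in triangles by move: fS; rewrite inE => /andP[].
have fU : f.1 \in U by move: fS; rewrite inE => /andP[].
have pos al be w : w != 0 -> f = (e.1 + al *: w, e.2 + be *: w) ->
    (0 < neighbours al be o e)%N.
  move=> w0 Ef; rewrite /neighbours (bigD1 w) ?w0 /=; last by move: fU; rewrite Ef.
  by rewrite eT -Ef fT.
have ne' : (f.1 == e.1) && (f.2 == e.2) = false.
  by apply: contraNF ne; case: (f) (e) => f1 f2 [e1 e2] /= /andP[/eqP-> /eqP->].
case/or3P: mt => [/eqP m1|/eqP m2|/eqP m3].
- apply: Or31.
  apply: (pos _ _ (f.2 - e.2)).
    by rewrite subr_eq0; move: ne'; rewrite m1 eqxx => /= ->.
  by rewrite scale0r scale1r addr0 -m1 addrC subrK; case: (f).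
- apply: Or32.
  apply: (pos _ _ (f.1 - e.1)).
    by rewrite subr_eq0; move: ne'; rewrite m2 eqxx andbT => /= ->.
  by rewrite scale0r scale1r addr0 -m2 addrC subrK; case: (f).
- apply: Or33.
  have f2 : f.2 = e.2 - (f.1 - e.1).
    by rewrite opprB addrA [e.2 + _]addrC -m3 addrC addKr.
  apply: (pos _ _ (f.1 - e.1)).
    rewrite subr_eq0; apply: contraFN ne' => /eqP m1; rewrite m1 eqxx /=.
    by rewrite f2 m1 subrr subr0.
  by rewrite scaleN1r scale1r -f2 addrC subrK; case: (f).
Qed.

(** [m] bounds the number of admissible displacements: it will be [p ^ r] when the first coordinate
    stays fixed, and [#|U|] when it moves inside [U]. *)
Lemma sum_neighbours (al be : 'F_p) (D m : nat) :
  (forall g, g \in triangles ->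
     #|[set y | (g.1 + al *: y, g.2 + be *: y)%R \in triangles]| <= D)%N ->
  (forall e, #|[set w : W | e + al *: w \in U]%R| <= m)%N ->
  (p ^ n * \sum_o \sum_(e | e.1 \in U) neighbours al be o e
     <= #|U| * p ^ r * m * (#|{: M}| * #|triangles| * D))%N.
Proof.
move=> deg cardm; rewrite exchange_big big_distrr /=.
have <- : #|[set e : W * W | e.1 \in U]| = (#|U| * p ^ r)%N.
  rewrite -(card_rV pr_p r) -[#|{: W}|]cardsT -cardsX.
  by apply: eq_card => e; rewrite !inE andbT.
rewrite -mulnA -sum_nat_const big_mkcond [leqRHS]big_mkcond /=.
apply: leq_sum => e _; rewrite inE; case: ifP => // eU.
rewrite exchange_big big_distrr /=.
apply: leq_trans (_ : \sum_(w in [set w : W | (e.1 + al *: w \in U)%R]) (#|{: M}| * #|triangles| * D) <= _)%N; last first.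
  by rewrite sum_nat_const leq_mul2r cardm orbT.
rewrite big_mkcond [leqRHS]big_mkcond /=; apply: leq_sum => w _; rewrite inE.
case: eqVneq => //= w0; case: ifP => // _.
apply: leq_trans (card_sample_pair pr_p e w0 deg).
by rewrite leq_mul2l -sum1dep_card [leqRHS]big_mkcond /= leq_sum ?orbT // => o _; case: (_ && _).
Qed.

(* Restricting only the first coordinate to the subset U is what allows the
   degrees D2 and D3 to be larger than D1. *)
Lemma triangles_random_restriction (D1 D2 D3 : nat) :
  (forall x, x \in X -> #|[set y in Y | x + y \in Z]%R| <= D1)%N ->
  (forall y, y \in Y -> #|[set x in X | x + y \in Z]%R| <= D2)%N ->
  (forall z, z \in Z -> #|[set x in X | z - x \in Y]%R| <= D3)%N ->
  (6 * p ^ r * D1 <= p ^ n)%N -> (6 * #|U| * D2 <= p ^ n)%N ->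
  (6 * #|U| * D3 <= p ^ n)%N ->
  (#|triangles| * (#|U| * p ^ r) <= 2 * (p ^ n) ^ 2 * (3 * #|low_monomials p r|))%N.
Proof.
move=> d1 d2 d3 le1 le2 le3.
have N0 : (0 < p ^ n)%N by rewrite expn_gt0 prime_gt0.
have M0 : (0 < #|{: M}|)%N by apply/card_gt0P; exists 0.
have cU (e : W) : (#|[set w : W | e + w \in U]%R| <= #|U|)%N.
  rewrite -(card_imset _ (@addrI _ e)); apply: subset_leq_card.
  by apply/subsetP => _ /imsetP[w + ->]; rewrite inE.
have b1 := @sum_neighbours 0 1 D1 (p ^ r)%N.
have b2 := @sum_neighbours 1 0 D2 #|U|.
have b3 := @sum_neighbours 1 (-1) D3 #|U|.
have {}b1 : (p ^ n * \sum_o \sum_(e | e.1 \in U) neighbours 0%R 1%R o e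
     <= #|U| * p ^ r * p ^ r * (#|{: M}| * #|triangles| * D1))%N.
  apply: b1 => [g|e]; last by rewrite -(card_rV pr_p r) max_card.
  rewrite inE => /and3P[gX gY gZ]; apply: leq_trans (d1 _ gX).
  rewrite -(card_imset _ (@addrI _ g.2)); apply: subset_leq_card.
  by apply/subsetP => _ /imsetP[w + ->]; rewrite !inE scale0r scale1r addr0 => /and3P[_ -> ->].
have {}b2 : (p ^ n * \sum_o \sum_(e | e.1 \in U) neighbours 1%R 0%R o e
     <= #|U| * p ^ r * #|U| * (#|{: M}| * #|triangles| * D2))%N.
  apply: b2 => [g|e]; last by under eq_finset do rewrite scale1r.
  rewrite inE => /and3P[gX gY gZ]; apply: leq_trans (d2 _ gY).
  rewrite -(card_imset _ (@addrI _ g.1)); apply: subset_leq_card.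
  by apply/subsetP => _ /imsetP[w + ->]; rewrite !inE scale0r scale1r addr0 => /and3P[-> _ ->].
have {}b3 : (p ^ n * \sum_o \sum_(e | e.1 \in U) neighbours 1%R (-1)%R o e
     <= #|U| * p ^ r * #|U| * (#|{: M}| * #|triangles| * D3))%N.
  apply: b3 => [g|e]; last by under eq_finset do rewrite scale1r.
  rewrite inE => /and3P[gX gY gZ]; apply: leq_trans (d3 _ gZ).
  rewrite -(card_imset _ (@addrI _ g.1)); apply: subset_leq_card.
  apply/subsetP => _ /imsetP[w + ->]; rewrite !inE scaleN1r scale1r => /and3P[-> + _].
  by rewrite opprD addrA [g.1 + g.2 - _]addrAC subrr add0r.
have total : (\sum_o #|sampled o| = #|U| * p ^ r * (#|{: M}| * #|triangles|))%N.
  have -> : (#|U| * p ^ r)%N = #|[set e : W * W | e.1 \in U]|.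
    rewrite -(card_rV pr_p r) -[#|{: W}|]cardsT -cardsX.
    by apply: eq_card => e; rewrite !inE andbT.
  rewrite -sum_nat_const.
  transitivity (\sum_o \sum_(e | e.1 \in U) (sample o e \in triangles))%N.
    apply: eq_bigr => o _; rewrite -sum1_card big_mkcond [RHS]big_mkcond.
    by apply: eq_bigr => e _; rewrite inE; do 2 case: (_ \in _).
  rewrite exchange_big /= big_mkcond [RHS]big_mkcond; apply: eq_bigr => e _.
  rewrite inE; case: ifP => // _; rewrite -(card_sample triangles e) -sum1dep_card.
  by rewrite [RHS]big_mkcond /=; apply: eq_bigr => o _; case: (_ \in _).
have iso_le : (\sum_o #|isolated o| <= #|{: M}| * (p ^ n) ^ 2 * (3 * #|low_monomials p r|))%N.
  have <- : #|{: M * (V * V)}| = (#|{: M}| * (p ^ n) ^ 2)%N.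
    by rewrite !card_prod !card_rV // mulnn.
  by rewrite -sum_nat_const; apply: leq_sum => o _; exact: card_isolated.
have : (\sum_o #|sampled o| <= \sum_o #|isolated o|
   + (\sum_o \sum_(e | e.1 \in U) neighbours 0%R 1%R o e
   + \sum_o \sum_(e | e.1 \in U) neighbours 1%R 0%R o e
   + \sum_o \sum_(e | e.1 \in U) neighbours 1%R (-1)%R o e))%N.
  rewrite -!big_split /=; apply: leq_sum => o _.
  by rewrite -!big_split /=; exact: card_sampled_le.
rewrite total => tot; exact: restriction_count N0 M0 le1 le2 le3 b1 b2 b3 iso_le tot.
Qed.

End RandomRestriction.

(** * The degree bound for triangles *)

Section TriangleBound.
Local Open Scope R_scope.

Lemma INR_expn (a b : nat) : INR (a ^ b)%N = INR a ^ b.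
Proof. by elim: b => // b IH; rewrite expnS mult_INR IH. Qed.

Lemma INR_leq (a b : nat) : (a <= b)%N -> INR a <= INR b.
Proof. by move=> le; apply/le_INR/leP. Qed.

Lemma leq_INR (a b : nat) : INR a <= INR b -> (a <= b)%N.
Proof. by move=> /INR_le /leP. Qed.

Lemma INR_floor (x : R) : 0 <= x -> exists k : nat, INR k <= x < INR k + 1.
Proof.
move=> x0; have [k lt_x] : exists k, x < INR k by have [k] := INR_unbounded x; exists k.
elim: k lt_x => [|k IH]; first by rewrite /=; lra.
rewrite S_INR => lt_x; case: (Rlt_le_dec x (INR k)) => [/IH //|le].
by exists k.
Qed.

Lemma exists_pow_between (a b B : R) : 2 <= b -> 0 < a -> a <= B ->
  exists r : nat, b ^ r * a <= B < b ^ r.+1 * a.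
Proof.
move=> b2 a0 aB; have [K ltK] : exists K, B < b ^ K * a.
  have [K ltK] := INR_unbounded (B / a); exists K.
  have le : INR K <= b ^ K.
    elim: K {ltK} => [|K IH]; first by rewrite /=; lra.
    rewrite S_INR /=; have := pow_R1_Rle b K ltac:(lra); nra.
  have : B = B / a * a by field; lra.
  nra.
elim: K ltK => [|K IH] ltK; first by rewrite /= in ltK; lra.
case: (Rlt_le_dec B (b ^ K * a)) => [/IH //|le].
by exists K.
Qed.

Lemma exists_set_card (T : finType) (k : nat) : (k <= #|T|)%N ->
  exists U : {set T}, #|U| = k.
Proof.
move=> le; exists [set enum_val (widen_ord le i) | i : 'I_k].
rewrite card_imset ?card_ord // => i j /enum_val_inj/(congr1 val) /= e.
exact: val_inj.
Qed.

Variables (p n : nat) (c : R).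
Hypotheses (pr_p : prime p) (hc : is_c_p3 p c).
Variables (X Y Z : {set 'rV['F_p]_n}) (ka t m n1 : R).
Let N := INR (p ^ n)%N.
Let d1 := 2 * t / n1.

(** With $p^r$ about $N/d_1$ and [U] of about $N/D$ elements, where $D = 2t/m$, random restriction
    bounds $t |U|$ by $N^2 p^{-rc}$ up to constants and [ka]. As $N/D$ is proportional to $m/t$, the
    number [t] of triangles cancels. *)
Lemma triangle_degree_bound :
  1 <= ka -> 0 < t -> 0 < m -> m <= n1 -> n1 <= ka * N ->
  t / ka <= INR #|triangles X Y Z| ->
  (forall x, x \in X -> INR #|[set y in Y | (x + y)%R \in Z]| <= d1) ->
  (forall y, y \in Y -> INR #|[set x in X | (x + y)%R \in Z]| <= 2 * t / m) ->
  (forall z, z \in Z -> INR #|[set x in X | (z - x)%R \in Y]| <= 2 * t / m) ->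
  m <= 864 * INR p ^ 2 * ka * N * Rpower (d1 / N) c.
Proof.
move=> ka1 t0 m0 mn1 n1N le_t deg1 deg2 deg3.
have c0 := c_p3_gt0 pr_p hc; have c1 := c_p3_le1 pr_p hc.
have p2 : 2 <= INR p by apply: (le_INR 2); apply/leP/prime_gt1.
have N0 : 0 < N by rewrite /N INR_expn; apply: pow_lt; lra.
pose D := 2 * t / m.
have D0 : 0 < D by apply: Rdiv_lt_0_compat; lra.
have d10 : 0 < d1 by apply: Rdiv_lt_0_compat; lra.
have Dm : D * m = 2 * t by rewrite /D; field; lra.
have dn : d1 * n1 = 2 * t by rewrite /d1; field; lra.
have dD : d1 <= D by nra.
have x0 : 0 < d1 / N by apply: Rdiv_lt_0_compat; lra.
have dN : d1 = d1 / N * N by field; lra.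
set x := d1 / N in x0 dN *.
have xc0 : 0 < Rpower x c by exact: exp_pos.
have kN : 0 < ka * N by nra.
have weak a : 1 <= a -> m <= a * (ka * N * Rpower x c) -> a <= 864 * INR p ^ 2 ->
    m <= 864 * INR p ^ 2 * ka * N * Rpower x c.
  move=> a1 le_a a_le; have : 0 < ka * N * Rpower x c by nra.
  nra.
have p4 : 4 <= INR p ^ 2 by simpl; nra.
(* First the cases where [N] is too small for a restriction: below [6 * d1], [Rpower x c] is at
   least 1/6; below [6 * D], the value of [D] already gives [m <= 6 * (ka * d1)]. *)
case: (Rlt_le_dec N (6 * d1)) => [lt6|le6].
  apply: (weak 6); try lra.
  have x6 : / 6 < x by nra.
  have : / 6 <= Rpower x c.
    apply: (Rle_trans _ (Rpower (/ 6) c)).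
      apply: (Rle_trans _ (Rpower (/ 6) 1)); first by rewrite Rpower_1; lra.
      rewrite /Rpower ln_Rinv; last lra.
      have l6 : 0 < ln 6 by rewrite -ln_1; apply: ln_increasing; lra.
      case: (Req_dec c 1) => [->|ne]; first lra.
      left; apply: exp_increasing; nra.
    apply: Rle_Rpower_l; lra.
  move=> le; have : ka * N * / 6 <= ka * N * Rpower x c by nra.
  lra.
have x1 : x <= / 6 by nra.
case: (Rlt_le_dec N (6 * D)) => [lt6|le6'].
  apply: (weak 6); try lra.
  have : m <= 6 * (ka * N * x).
    have : N * m <= 12 * t by nra.
    have -> : ka * N * x = ka * d1 by rewrite dN; ring.
    move=> h; have : m * n1 <= 6 * (ka * d1) * n1 by nra.
    move=> h2; apply: (Rmult_le_reg_r n1); lra.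
  have : x <= Rpower x c.
    rewrite -{1}(Rpower_1 x) //.
    have lx : ln x < 0 by rewrite -ln_1; apply: ln_increasing; lra.
    rewrite /Rpower; case: (Req_dec c 1) => [->|ne]; first lra.
    left; apply: exp_increasing; nra.
  nra.
have [r [le_r lt_r]] := exists_pow_between p2 (a := 6 * d1) ltac:(lra) le6.
pose M := INR (p ^ r)%N.
have M1 : 1 <= M by rewrite /M INR_expn; apply: pow_R1_Rle; lra.
have ME : M = INR p ^ r by rewrite /M INR_expn.
rewrite -ME in le_r; rewrite /= -ME in lt_r.
have [f [f_le f_gt]] := INR_floor (x := N / (6 * D)) ltac:(left; apply: Rdiv_lt_0_compat; lra).
have NE : N = N / (6 * D) * (6 * D) by field; lra.
have q1 : 1 <= N / (6 * D) by apply: (Rmult_le_reg_r (6 * D)); lra.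
(* Both terms are at least [N / (12 * INR p * D)]: the floor loses at most a factor 2, and the
   maximality of [r] bounds the loss in [p ^ r] by [INR p]. *)
pose M2 := minn (p ^ r) f.
have [U cU] : exists U : {set 'rV['F_p]_r}, #|U| = M2.
  by apply: exists_set_card; rewrite card_rV // geq_minl.
have M2f : INR M2 <= INR f by apply/INR_leq/geq_minr.
have M2_ge : N / (12 * INR p * D) <= INR M2.
  have -> : N / (12 * INR p * D) = N / (6 * D) / (2 * INR p) by field; lra.
  set q := N / (6 * D) in f_le f_gt NE q1 *.
  have half : q / (2 * INR p) <= q / 2.
    apply: Rmult_le_compat_l; first lra.
    apply: Rinv_le_contravar; lra.
  have f1 : 1 <= INR f.
    by apply: (le_INR 1); apply/leP; rewrite lt0n; apply/negP => /eqP f0; move: f_gt; rewrite f0 /=; lra.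
  rewrite /M2 /minn; case: ifP => _; last lra.
  apply: (Rmult_le_reg_r (2 * INR p)); first lra.
  rewrite /Rdiv Rmult_assoc Rinv_l; last lra.
  apply: (Rmult_le_reg_r (6 * D)); first lra.
  rewrite Rmult_1_r -NE -/M.
  have pM : 0 < INR p * M by nra.
  have pMD : 0 < INR p * M * D by nra.
  have := Rmult_le_compat_l _ _ _ (Rlt_le _ _ pM) dD; lra.
have [f1 [f1_le f1_gt]] := INR_floor (x := d1) ltac:(lra).
have [f2 [f2_le f2_gt]] := INR_floor (x := D) ltac:(lra).
have to_nat (a k : nat) y : INR a <= y -> y < INR k + 1 -> (a <= k)%N.
  by move=> le lt; rewrite -ltnS; apply/ltP/INR_lt; rewrite S_INR; lra.
have M20 := pos_INR M2.
have small2 : (6 * #|U| * f2 <= p ^ n)%N.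
  apply: leq_INR; rewrite cU !mult_INR -/N (_ : INR 6 = 6); last by rewrite /=; lra.
  have : INR M2 * INR f2 <= N / (6 * D) * D by apply: Rmult_le_compat; try lra; exact: pos_INR.
  lra.
have := @triangles_random_restriction p n r pr_p X Y Z U f1 f2 f2.
move=> /(_ (fun x xX => to_nat _ _ _ (deg1 x xX) f1_gt)).
move=> /(_ (fun x xX => to_nat _ _ _ (deg2 x xX) f2_gt)).
move=> /(_ (fun x xX => to_nat _ _ _ (deg3 x xX) f2_gt)).
have small1 : (6 * p ^ r * f1 <= p ^ n)%N.
  apply: leq_INR; rewrite !mult_INR -/N -/M (_ : INR 6 = 6); last by rewrite /=; lra.
  have := pos_INR f1; nra.
move=> /(_ small1 small2 small2) /INR_leq.
rewrite !mult_INR -/N -/M cU.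
have -> : INR 2 = 2 by [].
have -> : INR 3 = 3 by rewrite /=; lra.
have := card_low_monomials r (prime_gt0 pr_p) hc.
have -> : Rpower (INR p) (1 - c) ^ r = M * / Rpower M c.
  rewrite -Rpower_pow; last exact: exp_pos.
  rewrite Rpower_mult ME -(Rpower_pow r); last lra.
  rewrite Rpower_mult -Rpower_Ropp -Rpower_plus; congr Rpower; ring.
set Rl := INR #|_|; set t3 := INR _ in le_t *.
have Mc0 : 0 < Rpower M c by exact: exp_pos.
set Mc := Rpower M c in Mc0 *.
move=> Rl_le main.
have key : t3 * INR M2 * Mc <= 6 * N ^ 2.
  apply: (Rmult_le_reg_r (M * / Mc)).
    by apply: Rmult_lt_0_compat; [lra | apply: Rinv_0_lt_compat].
  have -> : t3 * INR M2 * Mc * (M * / Mc) = t3 * (INR M2 * M) by field; lra.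
  apply: (Rle_trans _ _ _ main).
  have -> : 6 * N ^ 2 * (M * / Mc) = 6 * (N * N) * (M * / Mc) by ring.
  have : 0 < N * N by nra.
  nra.
have mMc : m * Mc <= 144 * INR p * ka * N.
  have : t / ka * (N / (12 * INR p * D)) * Mc <= 6 * N ^ 2.
    apply: (Rle_trans _ _ _ _ key); apply: Rmult_le_compat_r; first lra.
    apply: Rmult_le_compat => //.
      by left; apply: Rdiv_lt_0_compat; lra.
    by left; apply: Rdiv_lt_0_compat; [lra | nra].
  have -> : t / ka * (N / (12 * INR p * D)) * Mc = N * (m * Mc) / (24 * INR p * ka).
    by rewrite /D; field; lra.
  move=> h; apply: (Rmult_le_reg_r (N / (24 * INR p * ka))).
    by apply: Rdiv_lt_0_compat; nra.
  have -> : m * Mc * (N / (24 * INR p * ka)) = N * (m * Mc) / (24 * INR p * ka) by field; lra.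
  have -> : 144 * INR p * ka * N * (N / (24 * INR p * ka)) = 6 * N ^ 2 by field; lra.
  exact: h.
apply: (weak (864 * INR p ^ 2)); try lra.
(* By maximality of [r], [N < INR p * M * (6 * d1)]. As $c \le 1$, the power of [6 * INR p] costs at
   most [6 * INR p], which turns 144 into 864 and squares [INR p]. *)
have big : 1 <= Mc * Rpower (6 * INR p) c * Rpower x c.
  rewrite /Mc !Rpower_mult_distr; try nra.
  apply: (Rle_trans _ (Rpower 1 c)); first by rewrite /Rpower ln_1 Rmult_0_r exp_0; lra.
  apply: Rle_Rpower_l; first lra.
  split; first lra.
  apply: (Rmult_le_reg_r N); first lra.
  have -> : M * (6 * INR p) * x * N = INR p * M * (6 * (x * N)) by ring.
  by rewrite -dN; lra.
have p6 : Rpower (6 * INR p) c <= 6 * INR p.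
  rewrite -{2}(Rpower_1 (6 * INR p)); last lra.
  apply: Rle_Rpower; lra.
have p60 : 0 < Rpower (6 * INR p) c by exact: exp_pos.
have pc : m <= m * (Mc * Rpower (6 * INR p) c * Rpower x c) by nra.
apply: (Rle_trans _ _ _ pc).
have -> : m * (Mc * Rpower (6 * INR p) c * Rpower x c) = (m * Mc) * Rpower (6 * INR p) c * Rpower x c by ring.
have -> : 864 * INR p ^ 2 * (ka * N * Rpower x c) = (144 * INR p * ka * N) * (6 * INR p) * Rpower x c by ring.
apply: Rmult_le_compat_r; first lra.
apply: Rmult_le_compat; try lra.
nra.
Qed.

End TriangleBound.

(** * Regularization of the cycle count *)

Lemma leq_expl a b e : a <= b -> a ^ e <= b ^ e.
Proof. by case: e => // e; rewrite leq_exp2r. Qed.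

Lemma card_tuples_le (p n k : nat) : prime p ->
  #|{: {ffun 'I_k -> 'rV['F_p]_n}}| <= 2 ^ (p * n * k).
Proof.
move=> pr_p; rewrite card_ffun card_ord card_rV // -mulnA [2 ^ _]expnM -expnM.
by apply: leq_expl; exact/ltnW/ltn_expl.
Qed.

Section Regularization.
Variables (p n k : nat).
Local Notation V := 'rV['F_p]_n.
Local Notation tuple := {ffun 'I_k -> V}.
Implicit Types (X : 'I_k -> {set V}) (Q : {set tuple}).

Definition disjoint_cycles X Q :=
  Q \subset cycles X /\
  forall f g j, f \in Q -> g \in Q -> f j = g j -> f = g.

Definition cycles_through X j x := [set f in cycles X | f j == x].

Lemma mem_cycles X (f : tuple) :
  (f \in cycles X) = [forall i, f i \in X i] && (\sum_i f i == 0)%R.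
Proof. by rewrite inE. Qed.

Definition delete X (j : 'I_k) (x : V) : 'I_k -> {set V} :=
  fun i => if i == j then X i :\ x else X i.

Lemma cycles_delete X j x : cycles (delete X j x) = cycles X :\: cycles_through X j x.
Proof.
apply/setP => f; rewrite in_setD /cycles_through in_set !mem_cycles.
case: (\sum_i _ == _)%R; rewrite ?andbF // !andbT.
apply/forallP/idP => [h|/andP[ne /forallP h] i].
  have hX : [forall i, f i \in X i].
    apply/forallP => i; move: (h i); rewrite /delete; case: ifP => // _.
    by rewrite in_setD => /andP[].
  rewrite hX /= andbT; move: (h j); rewrite /delete eqxx in_setD1.
  by case/andP.
rewrite /delete; case: eqP => // ->; rewrite in_setD1 h andbT.
by move: ne; rewrite (introT forallP h).
Qed.

Lemma num_cycles_delete X j x :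
  num_cycles X = num_cycles (delete X j x) + #|cycles_through X j x|.
Proof.
rewrite /num_cycles cycles_delete addnC cardsD (setIidPr _) ?subnKC //.
  by apply: subset_leq_card; apply/subsetP => f; rewrite inE => /andP[].
by apply/subsetP => f; rewrite inE => /andP[].
Qed.

Lemma disjoint_cycles_delete X Q j x mu : disjoint_cycles X Q -> mu.+1 < #|Q| ->
  exists2 Q', disjoint_cycles (delete X j x) Q' & mu < #|Q'|.
Proof.
move=> [/subsetP subQ disj] ltQ; pose Q' := [set f in Q | f j != x].
exists Q'.
  split; last by move=> f g i; rewrite !inE => /andP[fQ _] /andP[gQ _]; exact: disj.
  apply/subsetP => f; rewrite inE => /andP[fQ ne].
  by rewrite cycles_delete in_setD subQ // andbT in_set negb_and ne orbT.
have le1 : #|[set f in Q | f j == x]| <= 1.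
  apply/card_le1_eqP => f g; rewrite !inE => /andP[fQ /eqP fx] /andP[gQ /eqP gx].
  by apply: (disj _ _ j) => //; rewrite fx gx.
suff : #|Q| = #|[set f in Q | f j == x]| + #|Q'| by lia.
rewrite -(cardsID [set f : tuple | f j == x] Q); congr (_ + _); apply: eq_card => f.
  by rewrite !inE.
by rewrite !inE andbC.
Qed.

(* Deleting an element that lies in too many cycles divides their number by
   1 + K/m but destroys at most one member of Q. *)
Lemma regular_or_many_cycles m K mu X Q : disjoint_cycles X Q -> mu < #|Q| ->
  (exists X', [/\ forall i, X' i \subset X i, 0 < num_cycles X' &
     forall j x, #|cycles_through X' j x| * m <= K * num_cycles X'])
  \/ (m + K) ^ mu <= num_cycles X * m ^ mu.
Proof.
elim: mu X Q => [|mu IH] X Q disj ltQ.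
  right; rewrite !expn0 muln1; apply: leq_trans ltQ _.
  by apply: subset_leq_card; case: disj.
have pos : 0 < num_cycles X.
  by apply: leq_trans (leq_ltn_trans (leq0n _) ltQ) _; apply: subset_leq_card; case: disj.
case: (boolP [forall j, forall x, #|cycles_through X j x| * m <= K * num_cycles X]).
  move=> /forallP h; left; exists X; split => // j x.
  by move/forallP: (h j).
move=> /forallPn[j /forallPn[x]]; rewrite -ltnNge => bad.
have [Q' disj' ltQ'] := disjoint_cycles_delete j x disj ltQ.
case: (IH _ _ disj' ltQ') => [[X' [sub pos' reg]]|le].
  left; exists X'; split => // i; apply: subset_trans (sub i) _.
  by rewrite /delete; case: ifP => // _; rewrite subsetDl.
right; rewrite !expnS; have := num_cycles_delete X j x.
move: bad le; set T := num_cycles X; set T' := num_cycles _; set c := #|_|.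
set a := (m + K) ^ mu; set b := m ^ mu => bad le eT.
apply: leq_trans (_ : (m + K) * (T' * b) <= _); first by rewrite leq_mul2l le orbT.
rewrite mulnA [T * (m * b)]mulnA leq_mul2r; apply/orP; right.
rewrite eT in bad *; nia.
Qed.

(** With $K = 4(L+1)$, about $m/K$ factors $1 + K/m$ double a product, by Bernoulli. The 4 leaves
    room for $L + 1$ doublings among $m - 1$ factors in spite of rounding. *)
Lemma no_slow_growth (L m : nat) : 4 * L.+1 < m ->
  2 ^ L * m ^ m.-1 < (m + 4 * L.+1) ^ m.-1.
Proof.
move=> ltm; set K := 4 * L.+1 in ltm *.
pose a := (m %/ K).+1.
have aK : m <= a * K by rewrite /a; have := ltn_ceil m (_ : 0 < K); lia.
have double : 2 * m ^ a <= (m + K) ^ a.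
  have bern b : m ^ b.+1 + b.+1 * K * m ^ b <= (m + K) ^ b.+1.
    elim: b => [|b IH]; first by rewrite !expn1 expn0 muln1 mul1n.
    rewrite [(m + K) ^ _]expnS; apply: leq_trans (leq_mul (leqnn _) IH).
    rewrite [m ^ b.+2]expnS [m ^ b.+1]expnS; set y := m ^ b; nia.
  apply: leq_trans (bern _); rewrite -/a [m ^ a]expnS -/a.
  by rewrite mul2n -addnn leq_add2l leq_mul2r aK orbT.
have aL : a * L.+1 <= m.-1 by rewrite /a; have := leq_divM m K; lia.
have m0 : 0 < m by lia.
rewrite -(subnKC aL) !expnD !expnM mulnA.
apply: leq_trans (_ : 2 ^ L.+1 * (m ^ a) ^ L.+1 * m ^ (m.-1 - a * L.+1) <= _).
  by rewrite ltn_pmul2r ?ltn_pmul2r ?expn_gt0 ?m0 // ltn_exp2l.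
apply: leq_mul; last exact/leq_expl/leq_addr.
by rewrite -expnMn; exact: leq_expl.
Qed.

(** There are at most [2 ^ (p * n * k)] tuples in all, which rules out the growth alternative of
    [regular_or_many_cycles] for a constant that is only linear in [n]. *)
Lemma exists_regular X Q : prime p -> disjoint_cycles X Q -> 0 < #|Q| ->
  exists X', [/\ forall i, X' i \subset X i, 0 < num_cycles X' &
     forall j x, #|cycles_through X' j x| * #|Q|
       <= 4 * (p * n * k).+1 * num_cycles X'].
Proof.
move=> pr_p disj Q0; case: (leqP #|Q| (4 * (p * n * k).+1)) => [le|lt].
  exists X; split => //.
    by apply: leq_trans Q0 _; apply: subset_leq_card; case: disj.
  move=> j x; rewrite mulnC; apply: leq_mul => //; apply: subset_leq_card.
  by apply/subsetP => f; rewrite inE => /andP[].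
have ltQ : #|Q|.-1 < #|Q| by rewrite ltn_predL.
have [//|le] := regular_or_many_cycles #|Q| (4 * (p * n * k).+1) disj ltQ.
have := no_slow_growth lt; rewrite ltnNge; case/negP.
by apply: leq_trans le _; rewrite leq_mul2r (leq_trans (max_card _) (card_tuples_le n k pr_p)) orbT.
Qed.

End Regularization.

(** * Partial sums and their levels *)

Section PartialSums.
Local Open Scope ring_scope.
Import GRing.Theory.
Variables (p n k : nat) (X : 'I_k -> {set 'rV['F_p]_n}).
Local Notation V := 'rV['F_p]_n.
Local Notation tuple := {ffun 'I_k -> V}.
Implicit Types (I J P Q : {set 'I_k}) (s x y z : V) (f g : tuple).

(** Tuples vanish outside [J], so all index sets share one type and gluing over disjoint sets is
    pointwise addition. *)
Definition partial J s : {set tuple} :=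
  [set f : tuple | [forall j, if j \in J then f j \in X j else f j == 0]
                   && (\sum_j f j == s)].

Definition reps J s : nat := #|partial J s|.

Definition restr J f : tuple := [ffun j => if j \in J then f j else 0].

Definition psum J f : V := \sum_(j in J) f j.

Lemma partialP J s f : reflect ((forall j, if j \in J then f j \in X j else f j == 0)
  /\ \sum_j f j = s) (f \in partial J s).
Proof. by rewrite inE; apply: (iffP andP) => -[/forallP h /eqP e]. Qed.

Lemma sum_restr J f : \sum_j restr J f j = psum J f.
Proof. by rewrite /psum [RHS]big_mkcond; apply: eq_bigr => j _; rewrite ffunE. Qed.

Lemma restr_partial J f : (forall j, j \in J -> f j \in X j) ->
  restr J f \in partial J (psum J f).
Proof.
move=> h; apply/partialP; split; last exact: sum_restr.
by move=> j; rewrite ffunE; case: (boolP (j \in J)) => [/h //|_]; exact: eqxx.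
Qed.

Lemma cyclesP f : reflect ((forall j, f j \in X j) /\ \sum_j f j = 0) (f \in cycles X).
Proof. by rewrite inE; apply: (iffP andP) => -[/forallP h /eqP e]. Qed.

Lemma cycles_partial : cycles X = partial setT 0.
Proof.
apply/setP => f; apply/cyclesP/partialP => -[h e]; split => // j.
  by rewrite inE.
by have := h j; rewrite inE.
Qed.

Lemma psum_setC f J : f \in cycles X -> psum (~: J) f = - psum J f.
Proof.
move=> /cyclesP[_ e]; apply/eqP; rewrite -addr_eq0 addrC -e (bigID (mem J)) /=.
by apply/eqP; congr (_ + _); apply: eq_bigl => j; rewrite inE.
Qed.

Lemma psumU I J f : [disjoint I & J] -> psum (I :|: J) f = psum I f + psum J f.
Proof. by move=> d; rewrite /psum -bigU //=; apply: eq_bigl => j; rewrite !inE. Qed.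

Lemma psum0 f : psum set0 f = 0.
Proof. by rewrite /psum big_set0. Qed.

Lemma sum_reps_le I J s : [disjoint I & J] ->
  (\sum_x reps I x * reps J (s - x)%R <= reps (I :|: J) s)%N.
Proof.
move=> d.
pose G := [set u : tuple * tuple | (u.1 \in partial I (\sum_j u.1 j))
                                   && (u.2 \in partial J (s - \sum_j u.1 j))].
have -> : (\sum_x reps I x * reps J (s - x)%R)%N = #|G|.
  rewrite -sum1_card (partition_big (fun u : tuple * tuple => \sum_j u.1 j) xpredT) //=.
  apply: eq_bigr => x _; rewrite /reps -cardsX -sum1_card; apply: eq_bigl => -[u1 u2].
  rewrite in_setX [in RHS]inE /=; apply/andP/andP => [[h1 h2]|[/andP[h1 h2] /eqP <-] //].
  by have [_ e] := partialP _ _ _ h1; rewrite e h1 h2 eqxx.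
pose phi (u : tuple * tuple) : tuple := [ffun j => u.1 j + u.2 j].
have G1 u j : u \in G -> j \notin I -> u.1 j = 0.
  by rewrite inE => /andP[/partialP[h _] _] /negPf jI; have := h j; rewrite jI => /eqP.
have G2 u j : u \in G -> j \notin J -> u.2 j = 0.
  by rewrite inE => /andP[_ /partialP[h _]] /negPf jI; have := h j; rewrite jI => /eqP.
have dj j : j \in I -> j \notin J by move=> jI; rewrite (disjointFr d jI).
have inj : {in G &, injective phi}.
  move=> u v uG vG /ffunP e; case: u uG e => u1 u2 uG; case: v vG => v1 v2 vG e.
  congr (_, _); apply/ffunP => j; have := e j; rewrite !ffunE /=.
    case: (boolP (j \in I)) => jI; last by rewrite (G1 _ _ uG jI) (G1 _ _ vG jI).
    by rewrite (G2 _ _ uG (dj _ jI)) (G2 _ _ vG (dj _ jI)) !addr0.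
  case: (boolP (j \in J)) => jJ; last by rewrite (G2 _ _ uG jJ) (G2 _ _ vG jJ).
  have jI : j \notin I by apply: contraL jJ => /dj.
  by rewrite (G1 _ _ uG jI) (G1 _ _ vG jI) !add0r.
rewrite -(card_in_imset inj); apply: subset_leq_card.
apply/subsetP => _ /imsetP[u uG ->]; apply/partialP; split.
  move=> j; rewrite ffunE in_setU.
  have := uG; rewrite inE => /andP[/partialP[h1 _] /partialP[h2 _]].
  move: (h1 j) (h2 j); case: (boolP (j \in I)) => jI /=.
    by move=> jX; rewrite (negPf (dj _ jI)) => /eqP ->; rewrite addr0.
  by move=> /eqP ->; rewrite add0r.
have := uG; rewrite inE => /andP[/partialP[_ e1] /partialP[_ e2]].
under eq_bigr do rewrite ffunE.
by rewrite big_split /= e2 addrC subrK.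
Qed.

(** A tuple is determined by its restrictions to a cover. With [set0] for some of the sets this also
    serves for two or three parts. *)
Lemma card_cycles_psums_le I P Q R s x y z : I :|: P :|: Q :|: R = setT ->
  (#|[set f in cycles X | [&& psum I f == s, psum P f == x, psum Q f == y & psum R f == z]]|
     <= reps I s * reps P x * reps Q y * reps R z)%N.
Proof.
move=> cover; pose phi f := (restr I f, restr P f, restr Q f, restr R f).
rewrite -!cardsX -(card_imset _ (_ : injective phi)).
  apply: subset_leq_card; apply/subsetP => _ /imsetP[f + ->].
  rewrite inE => /andP[/cyclesP[h _]] /and4P[/eqP<- /eqP<- /eqP<- /eqP<-].
  by rewrite !in_setX /= !restr_partial.
move=> f g [/ffunP e1 /ffunP e2 /ffunP e3 /ffunP e4]; apply/ffunP => j.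
have : j \in I :|: P :|: Q :|: R by rewrite cover inE.
rewrite !in_setU -!orbA => /or4P[] jJ.
- by have := e1 j; rewrite !ffunE jJ.
- by have := e2 j; rewrite !ffunE jJ.
- by have := e3 j; rewrite !ffunE jJ.
- by have := e4 j; rewrite !ffunE jJ.
Qed.

Lemma reps_gt0 J f : f \in cycles X -> (0 < reps J (psum J f))%N.
Proof.
move=> /cyclesP[h _]; apply/card_gt0P; exists (restr J f).
exact: restr_partial.
Qed.

Lemma reps_le J s : prime p -> (reps J s <= 2 ^ (p * n * k))%N.
Proof. by move=> pr_p; apply: leq_trans (max_card _) (card_tuples_le n k pr_p). Qed.

Lemma reps1_le a x : (reps [set a] x <= 1)%N.
Proof.
apply/card_le1_eqP => f g /partialP[hf ef] /partialP[hg eg]; apply/ffunP => j.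
have zero h i : (forall j, if j \in [set a] then h j \in X j else h j == 0) ->
    i != a -> h i = 0 :> V.
  by move=> hh /negPf ia; have := hh i; rewrite inE ia => /eqP.
case: (eqVneq j a) => [->|ja]; last by rewrite !zero.
have at_a h : (forall j, if j \in [set a] then h j \in X j else h j == 0) ->
    \sum_j h j = x -> h a = x.
  by move=> hh <-; rewrite (bigD1 a) //= big1 ?addr0 // => i; exact: zero.
by rewrite !at_a.
Qed.

Lemma reps_setC1_le a x : x \in X a ->
  (reps (~: [set a]) (- x)%R <= #|cycles_through X a x|)%N.
Proof.
move=> xX; pose phi f : tuple := [ffun j => if j == a then x else f j].
have at_a f : f \in partial (~: [set a]) (- x) -> f a = 0.
  by move=> /partialP[h _]; have := h a; rewrite !inE eqxx => /eqP.
rewrite /reps -(card_in_imset (f := phi)).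
  apply: subset_leq_card; apply/subsetP => _ /imsetP[f fP ->].
  apply/setIdP; split; last by rewrite ffunE eqxx.
  apply/cyclesP; split.
    move=> j; rewrite ffunE; case: eqP => [->//|/eqP/negPf ja].
    by move: fP => /partialP[h _]; have := h j; rewrite !inE ja.
  move: (fP) => /partialP[_]; rewrite (bigD1 a) //= at_a // add0r => e.
  rewrite (bigD1 a) //= ffunE eqxx (eq_bigr f) ?e ?subrr // => j /negPf ja.
  by rewrite ffunE ja.
move=> f g fP gP /ffunP e; apply/ffunP => j; have := e j; rewrite !ffunE.
by case: eqP => // -> _; rewrite !at_a.
Qed.

End PartialSums.

Lemma pigeonhole (A B : finType) (C : {set A}) (f : A -> B) : 0 < #|C| ->
  exists b, #|C| <= #|[set a in C | f a == b]| * #|B|.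
Proof.
move=> /card_gt0P[a0 _]; pose F b := #|[set a in C | f a == b]|.
exists [arg max_(b > f a0) F b]; case: arg_maxnP => // b _ max_b.
rewrite -sum1_card (partition_big f xpredT) //= -[#|B|]sum1_card big_distrr /=.
apply: leq_sum => b' _; rewrite muln1; apply: leq_trans (max_b b' isT).
by rewrite /F -sum1dep_card.
Qed.

Lemma card_le_fibers (A B : finType) (C : {set A}) (f : A -> B) (D : {set B}) (b : B -> nat) :
  (forall a, a \in C -> f a \in D) ->
  (forall y, y \in D -> #|[set a in C | f a == y]| <= b y) ->
  #|C| <= \sum_(y in D) b y.
Proof.
move=> fD fib; rewrite -sum1_card (partition_big f (mem D)) //=.
by apply: leq_sum => y yD; apply: leq_trans (fib y yD); rewrite -sum1dep_card.
Qed.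

Lemma four_mul a b c : 4 * a * (b * c) = a * (2 * b * (2 * c)).
Proof. lia. Qed.

Section Levels.
Import GRing.Theory.
Variables (p n k : nat) (X : 'I_k -> {set 'rV['F_p]_n}).
Local Notation V := 'rV['F_p]_n.
Local Notation tuple := {ffun 'I_k -> V}.
Local Notation reps := (reps X).
Implicit Types (I J P Q : {set 'I_k}) (s x y z : V) (f g : tuple).

(** The number of ways to give each of the [2 ^ k] index sets a dyadic exponent between 0 and
    [p * n * k]. *)
Definition num_levels := (p * n * k).+1 ^ (2 ^ k).

Lemma exists_level_class : prime p -> 0 < num_cycles X ->
  exists (l : {set 'I_k} -> nat) (C : {set tuple}),
    [/\ C \subset cycles X, num_cycles X <= #|C| * num_levels &
      forall f J, f \in C -> 2 ^ l J <= reps J (psum J f) < 2 ^ (l J).+1].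
Proof.
move=> pr_p; pose lev f : {ffun {set 'I_k} -> 'I_(p * n * k).+1} :=
  [ffun J => inord (trunc_log 2 (reps J (psum J f)))].
move=> /(pigeonhole lev)[b le]; exists (fun J => nat_of_ord (b J)), [set f in cycles X | lev f == b].
split.
- by apply/subsetP => f; rewrite inE => /andP[].
- apply: leq_trans le _; rewrite leq_mul2l card_ffun card_ord /num_levels; apply/orP; right.
  by rewrite -cardsT -powersetT card_powerset cardsT card_ord.
move=> f J; rewrite inE => /andP[fX /eqP <-].
have r0 := reps_gt0 J fX; rewrite ffunE inordK; first by rewrite trunc_logP // trunc_log_ltn.
rewrite ltnS -(leq_exp2l _ _ (ltnSn 1)).
apply: leq_trans (trunc_logP _ r0) _ => //; exact: reps_le.
Qed.

Variables (l : {set 'I_k} -> nat) (C : {set tuple}).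
Hypotheses (subC : C \subset cycles X) (le_C : num_cycles X <= #|C| * num_levels)
  (C_gt0 : 0 < #|C|)
  (levC : forall f J, f \in C -> 2 ^ l J <= reps J (psum J f) < 2 ^ (l J).+1).

(** The typical partial sums. Prescribing the order of both the representations over [J] and the
    completions over [~: J] fixes the size of the level from both sides, by [card_level] and
    [card_class_le]. *)
Definition level J : {set V} :=
  [set s | (2 ^ l J <= reps J s < 2 ^ (l J).+1)
           && (2 ^ l (~: J) <= reps (~: J) (- s)%R < 2 ^ (l (~: J)).+1)].

Lemma levelP J s : s \in level J ->
  [/\ 2 ^ l J <= reps J s, reps J s <= 2 ^ (l J).+1,
      2 ^ l (~: J) <= reps (~: J) (- s)%R & reps (~: J) (- s)%R <= 2 ^ (l (~: J)).+1].
Proof. by rewrite inE => /andP[/andP[a /ltnW b] /andP[c /ltnW d]]. Qed.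

Lemma psum_level J f : f \in C -> psum J f \in level J.
Proof.
move=> fC; have fX := subsetP subC _ fC.
by rewrite inE levC //= -(psum_setC J fX) levC.
Qed.

Lemma card_level J : #|level J| * (2 ^ l J * 2 ^ l (~: J)) <= num_cycles X.
Proof.
have d : [disjoint J & ~: J] by rewrite -subsets_disjoint.
have := sum_reps_le X 0%R d; rewrite setUCr /num_cycles cycles_partial -/(reps _ _).
apply: leq_trans; rewrite -sum_nat_const big_mkcond; apply: leq_sum => s _.
case: ifP => // /levelP[a _ b _]; rewrite sub0r; exact: leq_mul.
Qed.

(** An extension of [s] over [P] followed by a completion of the result is a completion of [s], and
    the level of [s] bounds the number of those. *)
Lemma sum_extensions_le I P s : [disjoint I & P] -> s \in level I ->
  \sum_(y | (s + y)%R \in level (I :|: P)) reps P y * 2 ^ l (~: (I :|: P))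
    <= 2 ^ (l (~: I)).+1.
Proof.
move=> d /levelP[_ _ _]; apply: leq_trans.
have dP : [disjoint P & ~: (I :|: P)] by rewrite disjoints_subset setCK subsetUr.
have := sum_reps_le X (- s)%R dP.
have -> : P :|: ~: (I :|: P) = ~: I.
  apply/setP => j; rewrite !inE; case: (boolP (j \in P)) => jP; last by rewrite orbF.
  by rewrite (disjointFl d jP).
apply: leq_trans; rewrite big_mkcond; apply: leq_sum => y _.
case: ifP => // /levelP[_ _ a _].
by rewrite -opprD leq_mul2l a orbT.
Qed.

Lemma reps0_le x : reps set0 x <= 1.
Proof.
apply/card_le1_eqP => f g /partialP[hf _] /partialP[hg _]; apply/ffunP => j.
by have := hf j; have := hg j; rewrite inE => /eqP -> /eqP ->.
Qed.

Lemma card_class_le J : #|C| <= 4 * #|level J| * (2 ^ l J * 2 ^ l (~: J)).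
Proof.
rewrite [leqRHS](_ : _ = #|level J| * (2 ^ (l J).+1 * 2 ^ (l (~: J)).+1)); last first.
  by rewrite !expnS four_mul.
rewrite -sum_nat_const; apply: (card_le_fibers (f := psum J)) => [f fC|s sS].
  exact: psum_level.
have cover : J :|: set0 :|: set0 :|: ~: J = setT by rewrite !setU0 setUCr.
apply: leq_trans (_ : reps J s * reps set0 0%R * reps set0 0%R * reps (~: J) (- s)%R <= _).
  apply: leq_trans (card_cycles_psums_le X s 0 0 (- s)%R cover).
  apply: subset_leq_card; apply/subsetP => f; rewrite !inE => /andP[fC /eqP <-].
  have fX := subsetP subC _ fC; rewrite (psum_setC _ fX) !psum0 !eqxx !andbT.
  by move: fX; rewrite inE.
have [_ a _ b] := levelP sS.
apply: leq_trans (_ : 2 ^ (l J).+1 * 1 * 1 * 2 ^ (l (~: J)).+1 <= _).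
  by rewrite !leq_mul ?reps0_le.
by rewrite !muln1.
Qed.

(** A counting analogue of the submodularity of entropy. Once the condition on the sum over
    [I :|: P :|: Q] is dropped, the sums over [P] and [Q] vary independently given the one over [I];
    [card_level] then removes the size of [level I]. The 16 consists of a factor 2 each for [I] and
    the remaining indices, and one for each of the two extensions. *)
Lemma level_submodular I P Q :
  [disjoint I & P] -> [disjoint I & Q] -> [disjoint P & Q] ->
  2 ^ l (~: (I :|: P)) * 2 ^ l (~: (I :|: Q))
    <= 16 * num_levels * (2 ^ l (~: I) * 2 ^ l (~: (I :|: P :|: Q))).
Proof.
move=> dIP dIQ dPQ; set R := ~: (I :|: P :|: Q).
pose D := [set u : V * (V * V) | [&& u.1 \in level I, (u.1 + u.2.1)%R \in level (I :|: P),
   (u.1 + u.2.2)%R \in level (I :|: Q) & (u.1 + u.2.1 + u.2.2)%R \in level (I :|: P :|: Q)]].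
have cover : I :|: P :|: Q :|: R = setT by rewrite setUCr.
have dIPQ : [disjoint I :|: P & Q] by rewrite -setI_eq0 setIUl setU_eq0 !setI_eq0 dIQ dPQ.
pose c := 2 ^ (l I).+1 * 2 ^ (l R).+1.
have le1 : #|C| <= \sum_(u in D) c * (reps P u.2.1 * reps Q u.2.2).
  apply: (card_le_fibers (f := fun f => (psum I f, (psum P f, psum Q f)))) => [f fC|u].
    by rewrite inE /= -!psumU // !psum_level.
  rewrite inE => /and4P[/levelP[_ a _ _] _ _ /levelP[_ _ _ b]].
  apply: leq_trans (_ : reps I u.1 * reps P u.2.1 * reps Q u.2.2
      * reps R (- (u.1 + u.2.1 + u.2.2))%R <= _).
    apply: leq_trans (card_cycles_psums_le X _ _ _ _ cover).
    apply: subset_leq_card; apply/subsetP => f; rewrite !inE => /andP[fC /eqP <-] /=.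
    have fX := subsetP subC _ fC; rewrite (psum_setC _ fX) !psumU // !eqxx !andbT.
    by move: fX; rewrite inE.
  rewrite [leqLHS](_ : _ = reps I u.1 * reps R (- (u.1 + u.2.1 + u.2.2))%R * (reps P u.2.1 * reps Q u.2.2)).
    by rewrite leq_mul2r /c leq_mul ?orbT.
  by move: (reps P _) (reps Q _) (reps I _) (reps R _) => a1 a2 a3 a4; lia.
pose FP s := \sum_(y | (s + y)%R \in level (I :|: P)) reps P y.
pose FQ s := \sum_(z | (s + z)%R \in level (I :|: Q)) reps Q z.
have le2 : #|C| <= \sum_(s in level I) c * (FP s * FQ s).
  apply: leq_trans le1 _.
  have -> : \sum_(s in level I) c * (FP s * FQ s) =
    \sum_(s in level I) \sum_(v : V * V | ((s + v.1)%R \in level (I :|: P)) && ((s + v.2)%R \in level (I :|: Q)))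
      c * (reps P v.1 * reps Q v.2).
    apply: eq_bigr => s _; rewrite -big_distrr /=; congr (_ * _).
    rewrite big_distrlr /= (pair_big_dep (fun y => (s + y)%R \in level (I :|: P)) (fun _ z => (s + z)%R \in level (I :|: Q)) (fun y z => reps P y * reps Q z)) /=.
    by [].
  rewrite (pair_big_dep (fun s => s \in level I) (fun s v => ((s + v.1)%R \in level (I :|: P)) && ((s + v.2)%R \in level (I :|: Q))) (fun s v => c * (reps P v.1 * reps Q v.2))) /=.
  rewrite big_mkcond [leqRHS]big_mkcond; apply: leq_sum => u _ /=.
  rewrite inE; case: (_ \in level I) => //=; case: (_ \in _) => //=; case: (_ \in _) => //=.
  by case: ifP.
set a := 2 ^ l (~: (I :|: P)); set b := 2 ^ l (~: (I :|: Q)).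
have le3 : #|C| * (a * b) <= #|level I| * (c * (2 ^ (l (~: I)).+1 * 2 ^ (l (~: I)).+1)).
  apply: leq_trans (leq_mul le2 (leqnn _)) _.
  rewrite -sum_nat_const big_distrl /=; apply: leq_sum => s sI.
  rewrite -mulnA leq_mul2l mulnACA; apply/orP; right.
  apply: leq_mul; rewrite /FP /FQ big_distrl /=; exact: sum_extensions_le.
have := card_level I; move: le3 le_C C_gt0; rewrite /c !expnS.
move: (num_cycles X) num_levels #|C| #|level I| (2 ^ l I) (2 ^ l (~: I)) (2 ^ l R) (a * b) => T K Cc S AI AI' AR ab.
move=> le3 leT C0 leS; rewrite -(leq_pmul2l C0).
apply: leq_trans le3 _.
apply: leq_trans (_ : 16 * (AR * AI') * (Cc * K) <= _); last by rewrite [leqRHS](_ : _ = 16 * (AR * AI') * (Cc * K)) //; lia.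
apply: leq_trans (_ : 16 * (AR * AI') * (S * (AI * AI')) <= _); last by rewrite leq_mul2l (leq_trans leS) ?orbT.
by rewrite [leqLHS](_ : _ = 16 * (AR * AI') * (S * (AI * AI'))) //; lia.
Qed.

Lemma card_class_triangles I (a : 'I_k) : a \notin I ->
  #|C| <= 4 * #|triangles (level I) (level [set a]) (level (I :|: [set a]))|
          * (2 ^ l I * 2 ^ l (~: (I :|: [set a]))).
Proof.
move=> aI; have d : [disjoint I & [set a]] by rewrite disjoint_sym disjoints1.
set R := ~: (I :|: [set a]).
rewrite [leqRHS](_ : _ = #|triangles (level I) (level [set a]) (level (I :|: [set a]))|
   * (2 ^ (l I).+1 * 2 ^ (l R).+1)); last first.
  by rewrite !expnS four_mul.
rewrite -sum_nat_const; apply: (card_le_fibers (f := fun f => (psum I f, psum [set a] f))).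
  by move=> f fC; rewrite inE /= -psumU // !psum_level.
move=> u; rewrite inE => /and3P[/levelP[_ b _ _] _ /levelP[_ _ _ e]].
have cover : I :|: [set a] :|: set0 :|: R = setT by rewrite setU0 setUCr.
apply: leq_trans (_ : reps I u.1 * reps [set a] u.2 * reps set0 0%R * reps R (- (u.1 + u.2))%R <= _).
  apply: leq_trans (card_cycles_psums_le X _ _ 0 _ cover).
  apply: subset_leq_card; apply/subsetP => f; rewrite !inE => /andP[fC /eqP <-] /=.
  have fX := subsetP subC _ fC; rewrite (psum_setC _ fX) !psumU // !psum0 !eqxx !andbT.
  by move: fX; rewrite inE.
apply: leq_trans (_ : 2 ^ (l I).+1 * 1 * 1 * 2 ^ (l R).+1 <= _).
  by rewrite !leq_mul ?reps0_le ?reps1_le.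
by rewrite !muln1.
Qed.

Lemma level1 (a : 'I_k) : l [set a] = 0.
Proof.
have [f fC] := card_gt0P C_gt0.
have /andP[le _] := levC [set a] fC.
have := leq_trans le (reps1_le X a _).
by rewrite -[X in _ <= X](expn0 2) leq_exp2l // leqn0 => /eqP.
Qed.

Lemma level_setC1 (a : 'I_k) (K m : nat) :
  (forall x, #|cycles_through X a x| * m <= K * num_cycles X) ->
  2 ^ l (~: [set a]) * m <= K * num_cycles X.
Proof.
move=> reg; have [f fC] := card_gt0P C_gt0.
have fX := subsetP subC _ fC; have /andP[le _] := levC (~: [set a]) fC.
apply: leq_trans (reg (f a)); rewrite leq_mul2r; apply/orP; right.
apply: leq_trans le _; rewrite (psum_setC _ fX).
have -> : psum [set a] f = f a by rewrite /psum big_set1.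
by apply: reps_setC1_le; have /cyclesP[h _] := fX.
Qed.

End Levels.

(** * Descent along chains of index sets *)

Lemma other_le a b x y w q :
  a + b <= x + y + 2 * q -> x <= w -> y <= w -> w + q < a -> b <= w + q.
Proof. lia. Qed.

Section Descent.
Import GRing.Theory.
Variables (p n k : nat) (X : 'I_k -> {set 'rV['F_p]_n}).
Hypothesis pr_p : prime p.
Local Notation V := 'rV['F_p]_n.
Local Notation tuple := {ffun 'I_k -> V}.
Local Notation reps := (reps X).
Implicit Types (I J P Q : {set 'I_k}) (s x y z : V) (f g : tuple).
Variables (l : {set 'I_k} -> nat) (C : {set tuple}).
Local Notation level := (level X l).
Local Notation K2 := (num_levels p n k).
Hypotheses (subC : C \subset cycles X) (le_C : num_cycles X <= #|C| * K2)
  (C_gt0 : 0 < #|C|)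
  (levC : forall f J, f \in C -> 2 ^ l J <= reps J (psum J f) < 2 ^ (l J).+1).

Lemma reps1_level a x : x \in level [set a] -> 0 < reps [set a] x.
Proof. by move=> /levelP[le _ _ _]; apply: leq_trans le; rewrite expn_gt0. Qed.

(** This and the next two bounds share one reason: the triangles at a fixed vertex, with
    representations over the other index sets, give distinct representations of that vertex or of
    its negative, and its level bounds their number. *)
Lemma level_degree1 I a s : a \notin I -> s \in level I ->
  #|[set x in level [set a] | (s + x)%R \in level (I :|: [set a])]|
    * 2 ^ l (~: (I :|: [set a])) <= 2 ^ (l (~: I)).+1.
Proof.
move=> aI sI; have d : [disjoint I & [set a]] by rewrite disjoint_sym disjoints1.
apply: leq_trans (sum_extensions_le d sI); rewrite -sum_nat_const.
rewrite big_mkcond [leqRHS]big_mkcond; apply: leq_sum => x _; rewrite inE.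
case: (boolP (x \in _)) => // xa; case: (_ \in _) => //=.
by rewrite -{1}[2 ^ _]mul1n leq_mul2r reps1_level ?orbT.
Qed.

Lemma level_degree2 I a x : a \notin I -> x \in level [set a] ->
  #|[set s in level I | (s + x)%R \in level (I :|: [set a])]|
    * (2 ^ l I * 2 ^ l (~: (I :|: [set a]))) <= 2 ^ (l (~: [set a])).+1.
Proof.
move=> aI /levelP[_ _ _]; apply: leq_trans.
have dR : [disjoint I & ~: (I :|: [set a])] by rewrite disjoints_subset setCK subsetUl.
have := sum_reps_le X (- x)%R dR.
have -> : I :|: ~: (I :|: [set a]) = ~: [set a].
  apply/setP => j; rewrite !inE; case: (eqVneq j a) => [->|_]; first by rewrite (negPf aI).
  by rewrite orbF orbN.
apply: leq_trans; rewrite -sum_nat_const big_mkcond; apply: leq_sum => s _.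
rewrite inE; case: (boolP (s \in _)) => //= /levelP[h1 _ _ _].
case: ifP => // /levelP[_ _ h2 _].
by apply: leq_mul => //; rewrite -opprD [(x + s)%R]addrC.
Qed.

Lemma level_degree3 I a z : a \notin I -> z \in level (I :|: [set a]) ->
  #|[set s in level I | (z - s)%R \in level [set a]]| * 2 ^ l I
    <= 2 ^ (l (I :|: [set a])).+1.
Proof.
move=> aI /levelP[_ + _ _]; apply: leq_trans.
have d : [disjoint I & [set a]] by rewrite disjoint_sym disjoints1.
apply: leq_trans (sum_reps_le X z d).
rewrite -sum_nat_const big_mkcond; apply: leq_sum => s _.
rewrite inE; case: (boolP (s \in _)) => //= /levelP[h1 _ _ _].
case: ifP => // /reps1_level h2; rewrite -[2 ^ _]muln1; exact: leq_mul.
Qed.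

(* Apply [level_submodular] to (I, P, Q) and to the complementary triple
   (~: (I :|: P :|: Q), P, Q). *)
Lemma levels_cross I P Q (q : nat) :
  [disjoint I & P] -> [disjoint I & Q] -> [disjoint P & Q] -> 16 * K2 <= 2 ^ q ->
  l (I :|: P) + l (~: (I :|: P)) + (l (I :|: Q) + l (~: (I :|: Q)))
    <= l I + l (~: I) + (l (I :|: P :|: Q) + l (~: (I :|: P :|: Q))) + 2 * q.
Proof.
move=> dIP dIQ dPQ le_q.
have sub (A B D : {set 'I_k}) : [disjoint A & B] -> [disjoint A & D] -> [disjoint B & D] ->
    l (~: (A :|: B)) + l (~: (A :|: D)) <= q + (l (~: A) + l (~: (A :|: B :|: D))).
  move=> d1 d2 d3; have := level_submodular subC le_C C_gt0 levC d1 d2 d3.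
  rewrite -!expnD => le; rewrite -(leq_exp2l _ _ (ltnSn 1)) [in leqRHS]expnD.
  by apply: leq_trans le _; rewrite leq_mul2r le_q orbT.
have := sub _ _ _ dIP dIQ dPQ; set R := ~: (I :|: P :|: Q).
have [dRP dRQ] : [disjoint R & P] /\ [disjoint R & Q].
  by split; rewrite disjoint_sym disjoints_subset setCK ?subsetUr // -setUA setUCA subsetUl.
have := sub _ _ _ dRP dRQ dPQ.
have -> : ~: (R :|: P) = I :|: Q.
  apply/setP => j; rewrite !inE; move: (disjointFl dIP (x := j)) (disjointFl dPQ (x := j)).
  case: (j \in I); case: (j \in P); case: (j \in Q) => //= h1 h2;
    by [have := h1 isT | have := h2 isT].
have -> : ~: (R :|: Q) = I :|: P.
  apply/setP => j; rewrite !inE; move: (disjointFl dIQ (x := j)) (disjointFl dPQ (x := j)).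
  case: (j \in I); case: (j \in P); case: (j \in Q) => //= h1 h2;
    by [have := h1 isT | have := h2 isT].
have -> : ~: (R :|: P :|: Q) = I.
  apply/setP => j; rewrite !inE.
  move: (disjointFl dIQ (x := j)) (disjointFl dIP (x := j)).
  case: (j \in I); case: (j \in P); case: (j \in Q) => //= h1 h2;
    by [have := h1 isT | have := h2 isT].
rewrite /R setCK; lia.
Qed.

Local Open Scope R_scope.
Variable c : R.
Hypothesis hc : is_c_p3 p c.
Let T := INR (num_cycles X).
Let N := INR (p ^ n)%N.
Let G := 3456 * INR p ^ 2 * INR K2.

(** [T / 2 ^ W] plays the part of [m] in [triangle_degree_bound], solved for [d1]. In [G], 3456 is
    864 times 4, from [ka = 4 * INR K2]; [N / 2] undoes the 2 in [d1]. *)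
Definition descent_ratio (W : nat) : R :=
  N / 2 * Rpower (T / 2 ^ W / (G * N)) (/ c).


Lemma level_step (I : {set 'I_k}) (a : 'I_k) (W : nat) : a \notin I ->
  (l I + l (~: I) <= W)%N -> (l (~: [set a]) <= W)%N ->
  (l (I :|: [set a]) + l (~: (I :|: [set a])) <= W)%N ->
  descent_ratio W * 2 ^ l (~: (I :|: [set a])) <= 2 ^ l (~: I).
Proof.
move=> aI le_I le_a le_Ia; set S := ~: (I :|: [set a]).
have pow2 b : INR (2 ^ b)%N = 2 ^ b by rewrite INR_expn.
have pos b : 0 < 2 ^ b by apply: pow_lt; lra.
have pow_le_W b d : (b + d <= W)%N -> 2 ^ b * 2 ^ d <= 2 ^ W.
  by move=> le; rewrite -pow_add; apply: Rle_pow; [lra | apply/leP].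
have AIW := pow_le_W _ _ le_I; have AaW := pow_le_W _ 0%N ltac:(by rewrite addn0; exact: le_a).
have AIaW := pow_le_W _ _ le_Ia; rewrite -/S in AIaW.
have p2 : 2 <= INR p by apply: (le_INR 2); apply/leP/prime_gt1.
have K1 : 1 <= INR K2 by apply: (le_INR 1); apply/leP; rewrite expn_gt0.
have N0 : 0 < N by rewrite /N INR_expn; apply: pow_lt; lra.
have T0 : 0 < T.
  apply: (lt_INR 0); apply/ltP; apply: leq_trans C_gt0 _; exact: subset_leq_card.
have T_le : T <= INR #|C| * INR K2 by rewrite -mult_INR; apply: INR_leq.
have I0 := pos (l I); have I'0 := pos (l (~: I)); have R0 := pos (l S).
have W0 := pos W; have a0 := pos (l (~: [set a])); have Ia0 := pos (l (I :|: [set a])).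
have four : INR 4 = 4 by rewrite /=; lra.
have C1 := INR_leq (card_class_le subC levC I).
have C2 := INR_leq (card_class_triangles subC levC aI).
rewrite !mult_INR !pow2 -/S four in C1 C2.
have SN : INR #|level I| <= N.
  by apply: INR_leq; apply: leq_trans (max_card _) _; rewrite card_rV.
have deg1 s : s \in level I -> INR #|[set x in level [set a] | (s + x)%R \in level (I :|: [set a])]| * 2 ^ l S <= 2 * 2 ^ l (~: I).
  by move=> /(level_degree1 aI)/INR_leq; rewrite mult_INR !pow2.
have deg2 x : x \in level [set a] -> INR #|[set s in level I | (s + x)%R \in level (I :|: [set a])]| * (2 ^ l I * 2 ^ l S) <= 2 * 2 ^ l (~: [set a]).
  by move=> /(level_degree2 aI)/INR_leq; rewrite !mult_INR !pow2.
have deg3 z : z \in level (I :|: [set a]) -> INR #|[set s in level I | (z - s)%R \in level [set a]]| * 2 ^ l I <= 2 * 2 ^ l (I :|: [set a]).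
  by move=> /(level_degree3 aI)/INR_leq; rewrite !mult_INR !pow2.
have c0 := c_p3_gt0 pr_p hc.
rewrite Rmult_1_r in AaW.
set AI := 2 ^ l I in AIW I0 C1 C2 deg2 deg3 *; set AI' := 2 ^ l (~: I) in AIW I'0 C1 deg1 *.
set AR := 2 ^ l S in AIaW R0 C2 deg1 deg2 *; set Aa := 2 ^ l (~: [set a]) in AaW a0 deg2.
set AIa := 2 ^ l (I :|: [set a]) in AIaW Ia0 deg3.
have IR0 : 0 < AI * AR by nra.
have II0 : 0 < AI * AI' by nra.
(* Triangles and levels enter through their nominal numbers, with the dyadic and pigeonhole losses
   in [4 * INR K2]. The hypotheses on [W] say that all three nominal vertex counts are at least
   [T / 2 ^ W]. *)
have := @triangle_degree_bound p n c pr_p hc (level I) (level [set a]) (level (I :|: [set a]))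
  (4 * INR K2) (T / (AI * AR)) (T / 2 ^ W) (T / (AI * AI')).
have -> : 2 * (T / (AI * AR)) / (T / (AI * AI')) = 2 * AI' / AR by field; lra.
have -> : 2 * (T / (AI * AR)) / (T / 2 ^ W) = 2 * 2 ^ W / (AI * AR) by field; lra.
rewrite -/N => /(_ ltac:(lra)).
have div_le (y b z : R) : 0 < z -> y <= b * z -> y / z <= b.
  move=> z0 le; apply: (Rmult_le_reg_r z) => //.
  by have -> : y / z * z = y by field; lra.
have le_div (y b z : R) : 0 < z -> b * z <= y -> b <= y / z.
  move=> z0 le; apply: (Rmult_le_reg_r z) => //.
  by have -> : y / z * z = y by field; lra.
move=> /(_ ltac:(by apply: Rdiv_lt_0_compat)) /(_ ltac:(by apply: Rdiv_lt_0_compat)).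
have h1 : T / 2 ^ W <= T / (AI * AI').
  apply: Rmult_le_compat_l; first lra.
  exact: Rinv_le_contravar.
have h2 : T / (AI * AI') <= 4 * INR K2 * N.
  apply: (div_le) => //; have := Rmult_le_compat_r _ _ _ (Rlt_le _ _ II0) SN.
  move=> h; apply: (Rle_trans _ _ _ T_le); nra.
have h3 : T / (AI * AR) / (4 * INR K2) <= INR #|triangles (level I) (level [set a]) (level (I :|: [set a]))|.
  apply: (div_le); first lra.
  apply: (div_le) => //; nra.
move=> /(_ h1 h2 h3).
move=> /(_ (fun s sI => le_div _ _ _ R0 (deg1 s sI))).
have h4 b : b * (AI * AR) <= 2 * Aa -> b <= 2 * 2 ^ W / (AI * AR).
  by move=> le; apply: (le_div) => //; lra.
have h5 b : b * AI <= 2 * AIa -> b <= 2 * 2 ^ W / (AI * AR).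
  move=> le; apply: (le_div) => //; nra.
move=> /(_ (fun x xa => h4 _ (deg2 x xa)) (fun z zIa => h5 _ (deg3 z zIa))).
set d := 2 * AI' / AR => main.
have G0 : 0 < G by rewrite /G; nra.
have GN : 0 < G * N by nra.
have u_le : T / 2 ^ W / (G * N) <= Rpower (d / N) c.
  by apply: (div_le) => //; apply: (Rle_trans _ _ _ main); rewrite /G; right; ring.
have u0 : 0 < T / 2 ^ W / (G * N) by do 2 apply: Rdiv_lt_0_compat => //.
have d0 : 0 < d / N by do 2 apply: Rdiv_lt_0_compat => //; lra.
have root : Rpower (T / 2 ^ W / (G * N)) (/ c) <= d / N.
  apply: (Rle_trans _ (Rpower (Rpower (d / N) c) (/ c))).
    apply: Rle_Rpower_l; last by split.
    by left; apply: Rinv_0_lt_compat.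
  by rewrite Rpower_mult Rinv_r ?Rpower_1 //; lra.
rewrite /descent_ratio.
have -> : AI' = N / 2 * (d / N) * AR by rewrite /d; field; lra.
apply: Rmult_le_compat_r; first lra.
apply: Rmult_le_compat_l; lra.
Qed.

(* By [levels_cross], when the levels at I and J are small, so is the level at
   I :|: [set a] or the one at J minus a, up to q: one splits there. *)
Lemma level_descent (q W : nat) :
  (16 * K2 <= 2 ^ q)%N -> (forall a, l (~: [set a]) <= W)%N ->
  forall (d w : nat) (I J : {set 'I_k}), I \subset J -> #|J :\: I| = d ->
  (l I + l (~: I) <= w)%N -> (l J + l (~: J) <= w)%N -> (w + q * d <= W)%N ->
  descent_ratio W ^ d * 2 ^ l (~: J) <= 2 ^ l (~: I).
Proof.
move=> le_q le_a.
have p2 : 2 <= INR p by apply: (le_INR 2); apply/leP/prime_gt1.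
have N0 : 0 < N by rewrite /N INR_expn; apply: pow_lt; lra.
have th0 : 0 < descent_ratio W.
  by apply: Rmult_lt_0_compat; [lra | exact: exp_pos].
elim=> [|d IH] w I J sIJ card_d le_I le_J le_w.
  suff -> : J = I by rewrite /=; lra.
  apply/eqP; rewrite eqEsubset sIJ andbT -setD_eq0.
  by apply/eqP/cards0_eq.
have [a] : exists a, a \in J :\: I by apply/card_gt0P; rewrite card_d.
rewrite inE => /andP[aI aJ].
have sIaJ : I :|: [set a] \subset J by rewrite subUset sIJ sub1set.
have card_Ia : #|J :\: (I :|: [set a])| = d.
  have := cardsD1 a (J :\: I); rewrite inE aI aJ card_d setDDl /=; lia.
have step1 w' : (w' + q * d <= W)%N -> (w <= w')%N ->
    (l (I :|: [set a]) + l (~: (I :|: [set a])) <= w')%N ->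
    descent_ratio W ^ d.+1 * 2 ^ l (~: J) <= 2 ^ l (~: I).
  move=> le_w' ww' le_Ia.
  have h1 := IH w' _ _ sIaJ card_Ia le_Ia (leq_trans le_J ww') le_w'.
  have h2 : descent_ratio W * 2 ^ l (~: (I :|: [set a])) <= 2 ^ l (~: I).
    have wW := leq_trans (leq_addr _ _) le_w'.
    exact: (level_step aI (leq_trans le_I (leq_trans ww' wW)) (le_a a) (leq_trans le_Ia wW)).
  rewrite /= Rmult_assoc; nra.
case: (posnP d) => [d0|d_gt0].
  have EJ : J = I :|: [set a].
    apply/eqP; rewrite eqEsubset sIaJ andbT -setD_eq0.
    by apply/eqP/cards0_eq; rewrite card_Ia.
  by apply: (step1 w); rewrite -?EJ //; move: le_w; rewrite d0; lia.
pose Q := J :\: (I :|: [set a]).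
have dIa : [disjoint I & [set a]] by rewrite disjoint_sym disjoints1.
have dIQ : [disjoint I & Q].
  by rewrite disjoint_sym disjoints_subset /Q -setDDl setDE subIset // setDE subsetIr.
have daQ : [disjoint [set a] & Q] by rewrite disjoints1 !inE eqxx orbT.
have EIaQ : I :|: [set a] :|: Q = J by rewrite /Q setDE setUIr setUCr setIT (setUidPr sIaJ).
have := levels_cross dIa dIQ daQ le_q; rewrite EIaQ => cross.
(* Each splitting raises the threshold by [q], and [W] reserves [q] for every element still to be
   added. *)
have le_w' : (w + q + q * d <= W)%N by rewrite -addnA -mulnS.
case: (leqP (l (I :|: [set a]) + l (~: (I :|: [set a]))) (w + q)) => [le|gt].
  exact: (step1 (w + q)%N le_w' (leq_addr _ _) le).
have le_IQ := other_le cross le_I le_J gt.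
have card_Q : #|(I :|: Q) :\: I| = d.
  rewrite setDUl setDv set0U -card_Ia; congr #|pred_of_set _|.
  by apply/setDidPl; rewrite disjoint_sym.
have h1 := IH (w + q)%N I (I :|: Q) (subsetUl _ _) card_Q (leq_trans le_I (leq_addr _ _)) le_IQ le_w'.
have aIQ : a \notin I :|: Q by rewrite !inE eqxx orbT (negPf aI).
have EJ : I :|: Q :|: [set a] = J by rewrite -EIaQ setUAC.
have h2 : descent_ratio W * 2 ^ l (~: J) <= 2 ^ l (~: (I :|: Q)).
  have wW := leq_trans (leq_addr _ _) le_w'; have wW' := leq_trans (leq_addr _ _) wW.
  rewrite -EJ; apply: (level_step aIQ (leq_trans le_IQ wW) (le_a a)).
  by rewrite EJ; exact: leq_trans le_J wW'.
have : 0 < descent_ratio W ^ d by apply: pow_lt.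
rewrite /=; nra.
Qed.

End Descent.

(** * The cycle bound with a polynomial loss *)

Section WeakBound.
Local Open Scope R_scope.
Variables (p k : nat) (c : R).
Hypotheses (pr_p : prime p) (k_ge3 : (3 <= k)%N) (hc : is_c_p3 p c).

Definition predicted_cycles (n m : nat) : R :=
  INR m * (INR (p ^ n)%N * Rpower (INR m / INR (p ^ n)%N) (/ c)) ^ (k - 2).

(** [B] will be [p * n * k + 1]: then [4 * B] is the regularity constant, [B ^ (2 ^ k)] the number
    of level vectors, and the [k]-th power bounds [2 ^ (q * k)], the price of the splittings. *)
Definition loss (B : R) : R :=
  4 * B * (2 * Rpower (3456 * INR p ^ 2 * B ^ (2 ^ k) * (4 * B) * (32 * B ^ (2 ^ k)) ^ k) (/ c)) ^ (k - 2).

Lemma weak_cycle_bound (n : nat) (X : 'I_k -> {set 'rV['F_p]_n})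
    (Q : {set {ffun 'I_k -> 'rV['F_p]_n}}) :
  disjoint_cycles X Q -> (0 < #|Q|)%N ->
  predicted_cycles n #|Q| <= INR (num_cycles X) * loss (INR (p * n * k).+1).
Proof.
move=> disj Q0.
have [X' [sub T0 reg]] := exists_regular pr_p disj Q0.
have [l [C [subC le_C levC]]] := exists_level_class pr_p T0.
have C0 : (0 < #|C|)%N by move: (leq_trans T0 le_C); rewrite muln_gt0 => /andP[].
set K2 := num_levels p n k in le_C; set K := (4 * (p * n * k).+1)%N in reg.
pose q := (trunc_log 2 (16 * K2)).+1.
have K20 : (0 < K2)%N by rewrite expn_gt0.
have q_gt : (16 * K2 <= 2 ^ q)%N by exact/ltnW/trunc_log_ltn.
have q_le : (2 ^ q <= 32 * K2)%N.
  by rewrite expnS; have := @trunc_logP 2 (16 * K2) isT; rewrite muln_gt0 K20 => /(_ isT); lia.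
have k0 : (0 < k)%N by apply: leq_trans k_ge3.
have k1 : (1 < k)%N by apply: leq_trans k_ge3.
pose a := Ordinal k0; pose b := Ordinal k1.
(* Singletons have exponent 0, so [F i] is the whole exponent at [[set i]] and at its complement.
   Its maximum is a valid threshold at both ends of the chain. *)
pose F (i : 'I_k) := l (~: [set i]).
have [i0 max_i0] : exists i0, forall i, (F i <= F i0)%N.
  by exists [arg max_(i > a) F i]; case: arg_maxnP => // i _ h j; exact: h.
pose w := F i0; pose W := (w + q * k)%N.
have lev1 i : l [set i] = 0%N := level1 C0 levC i.
have le_w i : (l [set i] + l (~: [set i]) <= w)%N by rewrite lev1 max_i0.
have le_wC i : (l (~: [set i]) + l (~: (~: [set i])) <= w)%N by rewrite setCK lev1 addn0 max_i0.
have sub_ab : [set a] \subset ~: [set b] by rewrite sub1set !inE.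
have card_ab : #|(~: [set b]) :\: [set a]| = (k - 2)%N.
  rewrite setDE -setCU cardsCs setCK cardsU !cards1 card_ord.
  rewrite (_ : [set b] :&: [set a] = set0) ?cards0 //.
  by apply/setP => j; rewrite !inE; case: eqP => [->|].
have le_W : (w + q * (k - 2) <= W)%N by rewrite leq_add2l leq_mul2l leq_subr orbT.
have wW : (w <= W)%N by exact: leq_addr.
have desc := level_descent pr_p subC le_C C0 levC hc q_gt
  (fun i => leq_trans (max_i0 i) wW) sub_ab card_ab (le_w a) (le_wC b) le_W.
rewrite setCK lev1 /= Rmult_1_r in desc.
have reg_i i : INR #|Q| * 2 ^ l (~: [set i]) <= INR K * INR (num_cycles X').
  have /INR_leq := level_setC1 subC C0 levC (reg i).
  by rewrite !mult_INR INR_expn Rmult_comm.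
set T := INR (num_cycles X') in reg_i desc *.
have TX : T <= INR (num_cycles X).
  apply/INR_leq/subset_leq_card/subsetP => f /cyclesP[h e]; apply/cyclesP; split => // j.
  exact: (subsetP (sub j)).
pose B := INR (p * n * k).+1.
have B1 : 1 <= B by apply: (le_INR 1); apply/leP.
have KE : INR K = 4 * B by rewrite mult_INR (_ : INR 4 = 4) // /=; lra.
have K2E : INR K2 = B ^ (2 ^ k) by rewrite INR_expn.
have p2 : 2 <= INR p by apply: (le_INR 2); apply/leP/prime_gt1.
have m0 : 0 < INR #|Q| by apply: (lt_INR 0); apply/ltP.
have K21 : 1 <= B ^ (2 ^ k) by rewrite -K2E; apply: (le_INR 1); apply/leP.
have TT0 : 0 < T by apply: (lt_INR 0); apply/ltP.
have c0 := c_p3_gt0 pr_p hc; have ic0 : 0 < / c by exact: Rinv_0_lt_compat.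
set m := INR #|Q| in reg_i m0 *.
rewrite /predicted_cycles -/m -/B.
set N := INR (p ^ n)%N.
have N0 : 0 < N by rewrite /N INR_expn; apply: pow_lt; lra.
have p0 : 0 < INR p ^ 2 by apply: pow_lt; lra.
pose Z := (32 * B ^ (2 ^ k)) ^ k.
have Z0 : 0 < Z by apply: pow_lt; lra.
set H := 3456 * INR p ^ 2 * B ^ (2 ^ k) * (4 * B) * (32 * B ^ (2 ^ k)) ^ k.
have HE : H = 3456 * INR p ^ 2 * B ^ (2 ^ k) * (4 * B) * Z by [].
have G0 : 0 < 3456 * INR p ^ 2 * B ^ (2 ^ k) by apply: Rmult_lt_0_compat; lra.
have H0 : 0 < H by rewrite HE; apply: Rmult_lt_0_compat => //; nra.
(* Regularity at the maximizing index [i0] shows that [T / 2 ^ W] is at least [m] up to the loss. *)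
have twoW : 2 ^ W * m <= 4 * B * T * Z.
  rewrite /W pow_add pow_mult.
  have h1 := reg_i i0; rewrite KE -/(F i0) -/w in h1.
  have h2 : (2 ^ q) ^ k <= Z.
    apply: pow_incr; split; first by left; apply: pow_lt; lra.
    have := INR_leq q_le; rewrite INR_expn mult_INR K2E (_ : INR 32 = 32) //.
    by rewrite /=; lra.
  have h3 : 0 < (2 ^ q) ^ k by apply/pow_lt/pow_lt; lra.
  have h4 : 0 < m * 2 ^ w by apply: Rmult_lt_0_compat => //; apply: pow_lt; lra.
  have -> : 2 ^ w * (2 ^ q) ^ k * m = (m * 2 ^ w) * (2 ^ q) ^ k by ring.
  by apply: Rmult_le_compat; lra.
have W0 : 0 < 2 ^ W by apply: pow_lt; lra.
have ratio_ge : N * Rpower (m / N) (/ c) / (2 * Rpower H (/ c)) <= descent_ratio X' c W.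
  rewrite /descent_ratio -/N -/T -/K2 K2E.
  have R0 : 0 < Rpower H (/ c) by exact: exp_pos.
  have -> : N * Rpower (m / N) (/ c) / (2 * Rpower H (/ c)) = N / 2 * (Rpower (m / N) (/ c) * / Rpower H (/ c)).
    by field; lra.
  apply: Rmult_le_compat_l; first lra.
  have -> : / Rpower H (/ c) = Rpower (/ H) (/ c) by rewrite /Rpower ln_Rinv // -exp_Ropp; congr exp; ring.
  have iH : 0 < / H by exact: Rinv_0_lt_compat.
  have mN : 0 < m / N by exact: Rdiv_lt_0_compat.
  rewrite Rpower_mult_distr //; apply: Rle_Rpower_l; first lra.
  split; first exact: Rmult_lt_0_compat.
  set G := 3456 * _ * _ in G0 HE *.
  apply: (Rmult_le_reg_r (2 ^ W * H * N)); first by apply: Rmult_lt_0_compat => //; apply: Rmult_lt_0_compat.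
  have -> : m / N * / H * (2 ^ W * H * N) = 2 ^ W * m by field; lra.
  have -> : T / 2 ^ W / (G * N) * (2 ^ W * H * N) = T * H / G by field; lra.
  rewrite HE; have -> : T * (G * (4 * B) * Z) / G = 4 * B * T * Z by field; lra.
  exact: twoW.
have D0 : 0 < 2 * Rpower H (/ c) by apply: Rmult_lt_0_compat; [lra | exact: exp_pos].
set D := 2 * _ in D0 ratio_ge *.
set A := N * _ in ratio_ge *.
have A0 : 0 < A by apply: Rmult_lt_0_compat => //; exact: exp_pos.
have AD : (A / D) ^ (k - 2) <= 2 ^ l (~: [set a]).
  apply: Rle_trans desc; apply: pow_incr; split => //.
  by left; apply: Rdiv_lt_0_compat.
have Dk : 0 < D ^ (k - 2) by apply: pow_lt.
have -> : m * A ^ (k - 2) = m * (A / D) ^ (k - 2) * D ^ (k - 2).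
  rewrite Rmult_assoc -Rpow_mult_distr /Rdiv Rmult_assoc Rinv_l ?Rmult_1_r //.
  exact: Rgt_not_eq.
rewrite -Rmult_assoc; apply: Rmult_le_compat_r; first exact: Rlt_le.
apply: (Rle_trans _ (m * 2 ^ l (~: [set a]))); first by apply: Rmult_le_compat_l; lra.
apply: (Rle_trans _ _ _ (reg_i a)); rewrite KE.
have := Rmult_le_compat_l (4 * B) _ _ ltac:(lra) TX; lra.
Qed.

(** Only the shape matters: a constant times a fixed power of [B], so its logarithm grows like the
    logarithm of [n]. *)
Lemma loss_polynomial : exists C E, 0 <= E /\
  forall B, 1 <= B -> loss B = exp (C + E * ln B).
Proof.
have c0 := c_p3_gt0 pr_p hc; have ic0 : 0 < / c by exact: Rinv_0_lt_compat.
have p2 : 2 <= INR p by apply: (le_INR 2); apply/leP/prime_gt1.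
pose e := INR (2 ^ k)%N; pose d := INR (k - 2).
have e0 : 0 <= e by exact: pos_INR.
have d0 : 0 <= d by exact: pos_INR.
have k0 : 0 <= INR k by exact: pos_INR.
exists (ln 4 + d * (ln 2 + / c * (ln 3456 + 2 * ln (INR p) + ln 4 + INR k * ln 32))).
exists (1 + d * (/ c * (e + 1 + INR k * e))); split.
  have h : 0 <= / c * (e + 1 + INR k * e) by apply: Rmult_le_pos; nra.
  nra.
move=> B B1.
have Bp j : 0 < B ^ j by apply: pow_lt; lra.
have pp : 0 < INR p ^ 2 by apply: pow_lt; lra.
have Zp j : 0 < (32 * B ^ (2 ^ k)) ^ j by apply: pow_lt; have := Bp (2 ^ k)%N; lra.
have e1 : ln (B ^ (2 ^ k)) = e * ln B by rewrite ln_pow //; lra.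
pose H := 3456 * INR p ^ 2 * B ^ (2 ^ k) * (4 * B) * (32 * B ^ (2 ^ k)) ^ k.
have h1 : 0 < 3456 * INR p ^ 2 by lra.
have h2 : 0 < 3456 * INR p ^ 2 * B ^ (2 ^ k) by exact: Rmult_lt_0_compat.
have h3 : 0 < 3456 * INR p ^ 2 * B ^ (2 ^ k) * (4 * B) by apply: Rmult_lt_0_compat => //; lra.
have H0 : 0 < H by exact: Rmult_lt_0_compat.
have lnH : ln H = ln 3456 + 2 * ln (INR p) + e * ln B + (ln 4 + ln B) + INR k * (ln 32 + e * ln B).
  have B0 : 0 < B by lra.
  have p0 : 0 < INR p by lra.
  have n4 : 0 < 4 by lra.
  have n32 : 0 < 32 by lra.
  have n3456 : 0 < 3456 by lra.
  have h4 : 0 < 4 * B by lra.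
  have h32 : 0 < 32 * B ^ (2 ^ k) by have := Bp (2 ^ k)%N; lra.
  rewrite /H (ln_mult _ _ h3 (Zp k)) (ln_mult _ _ h2 h4) (ln_mult _ _ h1 (Bp _)).
  rewrite (ln_mult _ _ n3456 pp) (ln_mult _ _ n4 B0) (ln_pow _ h32) (ln_mult _ _ n32 (Bp _)).
  by rewrite !e1 (ln_pow _ p0).
have P0 : 0 < 2 * Rpower H (/ c) by apply: Rmult_lt_0_compat; [lra | exact: exp_pos].
rewrite -[LHS]exp_ln; last by rewrite /loss; apply: Rmult_lt_0_compat; [lra | exact: pow_lt].
have b4 : 0 < 4 * B by lra.
have n4 : 0 < 4 by lra.
have n2 : 0 < 2 by lra.
have B0 : 0 < B by lra.
congr exp; rewrite /loss -/H (ln_mult _ _ b4 (pow_lt _ _ P0)) (ln_mult _ _ n4 B0).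
rewrite (ln_pow _ P0) (ln_mult _ _ n2 (exp_pos _)).
rewrite ln_exp lnH -/d; ring.
Qed.

End WeakBound.

(** * Tensor powers *)

Section TensorPower.
Import GRing.Theory.
Local Open Scope ring_scope.
Variables (p n k r : nat).
Local Notation V := 'rV['F_p]_n.
Local Notation VR := 'rV['F_p]_(r * n).

Definition components (g : {ffun 'I_k -> VR}) : {ffun 'I_r -> {ffun 'I_k -> V}} :=
  [ffun i => [ffun j => row i (vec_mx (g j))]].

Definition assemble (F : {ffun 'I_r -> {ffun 'I_k -> V}}) : {ffun 'I_k -> VR} :=
  [ffun j => mxvec (\matrix_(i, c) F i j 0 c)].

Lemma assembleK : cancel assemble components.
Proof.
move=> F; apply/ffunP => i; apply/ffunP => j; apply/rowP => c.
by rewrite !ffunE mxvecK !mxE.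
Qed.

Lemma components_inj : injective components.
Proof.
move=> f g /ffunP e; apply/ffunP => j; apply: (can_inj vec_mxK); apply/row_matrixP => i.
by have := congr1 (fun h : {ffun 'I_k -> V} => h j) (e i); rewrite !ffunE.
Qed.

Definition set_power (A : {set V}) : {set VR} :=
  [set v | [forall i, row i (vec_mx v) \in A]].

Lemma cycles_power (X : 'I_k -> {set V}) (g : {ffun 'I_k -> VR}) :
  (g \in cycles (fun j => set_power (X j))) = [forall i, components g i \in cycles X].
Proof.
have row_sum i : \sum_j components g i j = row i (vec_mx (\sum_j g j)).
  by rewrite !linear_sum; apply: eq_bigr => j _; rewrite !ffunE.
apply/cyclesP/forallP => [[h e] i|h].
  apply/cyclesP; split; last by rewrite row_sum e !linear0.
  by move=> j; rewrite !ffunE; have := h j; rewrite inE => /forallP.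
split=> [j|].
  rewrite inE; apply/forallP => i; have /cyclesP[/(_ j)] := h i.
  by rewrite !ffunE.
apply: (can_inj vec_mxK); apply/row_matrixP => i.
by rewrite -row_sum !linear0; have /cyclesP[] := h i.
Qed.

Lemma num_cycles_power (X : 'I_k -> {set V}) :
  (num_cycles (fun j => set_power (X j)) <= num_cycles X ^ r)%N.
Proof.
rewrite /num_cycles -[r in (_ ^ r)%N]card_ord -card_ffun_on -[leqLHS](card_imset _ components_inj).
apply: subset_leq_card; apply/subsetP => _ /imsetP[g gX ->].
by rewrite cycles_power in gX; apply/ffun_onP => i; move/forallP: gX.
Qed.

(** Coordinate [j] of an assembled tuple contains, row by row, coordinate [j] of every component, so
    agreement there forces agreement of all components. *)
Lemma disjoint_cycles_power (X : 'I_k -> {set V}) (Q : {set {ffun 'I_k -> V}}) :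
  disjoint_cycles X Q ->
  exists2 Q', disjoint_cycles (fun j => set_power (X j)) Q' & #|Q'| = (#|Q| ^ r)%N.
Proof.
move=> [subQ disj]; exists (assemble @: ffun_on (mem Q)).
  split.
    apply/subsetP => _ /imsetP[F /ffun_onP FQ ->]; rewrite cycles_power assembleK.
    by apply/forallP => i; exact: (subsetP subQ).
  move=> _ _ j /imsetP[F /ffun_onP FQ ->] /imsetP[F' /ffun_onP FQ' ->] e.
  congr assemble; apply/ffunP => i; apply: (disj _ _ j (FQ i) (FQ' i)).
  have comp (G : {ffun 'I_r -> {ffun 'I_k -> V}}) : G i j = row i (vec_mx (assemble G j)).
    by rewrite -{1}(assembleK G) 2!ffunE.
  by rewrite comp e -comp.
by rewrite card_imset ?card_ffun_on ?card_ord //; exact: can_inj assembleK.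
Qed.

End TensorPower.

Section CycleBound.
Local Open Scope R_scope.
Variables (p k : nat) (c : R).
Hypotheses (pr_p : prime p) (k_ge3 : (3 <= k)%N) (hc : is_c_p3 p c).

Lemma predicted_cycles_gt0 n m : (0 < m)%N -> 0 < predicted_cycles p k c n m.
Proof.
move=> m0; have p0 : 0 < INR p by apply: (lt_INR 0); apply/ltP/prime_gt0.
apply: Rmult_lt_0_compat; first by apply: (lt_INR 0); apply/ltP.
apply: pow_lt; apply: Rmult_lt_0_compat; last exact: exp_pos.
by rewrite INR_expn; apply: pow_lt.
Qed.

Lemma predicted_cycles_power n m r : (0 < m)%N ->
  predicted_cycles p k c (r * n) (m ^ r) = predicted_cycles p k c n m ^ r.
Proof.
move=> m0; have p0 : 0 < INR p by apply: (lt_INR 0); apply/ltP/prime_gt0.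
have M0 : 0 < INR m by apply: (lt_INR 0); apply/ltP.
rewrite /predicted_cycles mulnC expnM !INR_expn.
set N := INR p ^ n; have N0 : 0 < N by exact: pow_lt.
have mN : 0 < INR m / N by exact: Rdiv_lt_0_compat.
have -> : INR m ^ r / N ^ r = (INR m / N) ^ r by rewrite /Rdiv Rpow_mult_distr pow_inv.
have -> : Rpower ((INR m / N) ^ r) (/ c) = Rpower (INR m / N) (/ c) ^ r.
  rewrite -Rpower_pow // Rpower_mult -Rpower_pow; last exact: exp_pos.
  by rewrite Rpower_mult Rmult_comm.
rewrite [RHS]Rpow_mult_distr -[N ^ r * _]Rpow_mult_distr; congr (_ * _).
by rewrite -!pow_mult Nat.mul_comm.
Qed.

(** Divide by [r] and let it grow. Along squares [r = s * s] the crude estimate [ln s <= s] is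
    enough. *)
Lemma subexponential_loss (x y C E b : R) : 0 <= E -> 1 <= b ->
  (forall r : nat, (0 < r)%N -> INR r * x <= INR r * y + (C + E * (ln b + ln (INR r)))) ->
  x <= y.
Proof.
move=> E0 b1 h; case: (Rle_lt_dec x y) => // lt; exfalso.
have lb : 0 <= ln b.
  by case: (Rle_lt_or_eq_dec 1 b b1) => [/(ln_increasing _ _ Rlt_0_1)|<-]; rewrite ln_1; lra.
pose M := Rabs C + E * ln b + 2 * E.
have M0 : 0 <= M by have := Rabs_pos C; rewrite /M; nra.
have [s [_ s_gt]] : exists s : nat, True /\ M / (x - y) + 1 < INR s.
  by have [s] := INR_unbounded (M / (x - y) + 1); exists s.
have q0 : 0 <= M / (x - y) by apply: Rmult_le_pos => //; left; apply: Rinv_0_lt_compat; lra.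
have s1 : 1 < INR s by lra.
have sp : (0 < s * s)%N by rewrite muln_gt0 andbb; apply/ltP/INR_lt => /=; lra.
have := h _ sp; rewrite mult_INR ln_mult; try lra.
have ln_s : ln (INR s) <= INR s.
  have := exp_ineq1_le (ln (INR s)); rewrite exp_ln; lra.
have C_le := Rle_abs C; have aC := Rabs_pos C.
have big : M < INR s * (x - y).
  have : M = M / (x - y) * (x - y) by field; lra.
  nra.
have : C + E * (ln b + (ln (INR s) + ln (INR s))) <= M * INR s.
  have : E * ln (INR s) <= E * INR s by exact: Rmult_le_compat_l.
  have : 0 <= E * ln b by exact: Rmult_le_pos.
  rewrite /M; nra.
nra.
Qed.

(** In logarithms, the weak bound for the [r]-th power carries a factor [r] on both main terms,
    while the loss grows only with [ln r], as [p * (r * n) * k + 1] is at most [r] times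
    [p * n * k + 1]. *)
Lemma cycle_bound (n : nat) (X : 'I_k -> {set 'rV['F_p]_n})
    (Q : {set {ffun 'I_k -> 'rV['F_p]_n}}) :
  disjoint_cycles X Q -> (0 < #|Q|)%N ->
  predicted_cycles p k c n #|Q| <= INR (num_cycles X).
Proof.
move=> disj Q0; have [C [E [E0 lossE]]] := loss_polynomial k pr_p hc.
set b := predicted_cycles _ _ _ _ _; have b0 : 0 < b by exact: predicted_cycles_gt0.
have T0 : 0 < INR (num_cycles X).
  apply: (lt_INR 0); apply/ltP; apply: leq_trans Q0 _; apply: subset_leq_card.
  by case: disj.
set T := INR _ in T0 *.
pose B := INR (p * n * k).+1; have B1 : 1 <= B by apply: (le_INR 1); apply/leP.
suff le_ln : ln b <= ln T by rewrite -(exp_ln b) // -(exp_ln T) //; case: (Rle_lt_or_eq_dec _ _ le_ln) => [/exp_increasing|->]; lra.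
apply: (subexponential_loss (C := C) E0 B1) => r r0.
have [Q' disj' cQ'] := disjoint_cycles_power r disj.
have Q'0 : (0 < #|Q'|)%N by rewrite cQ' expn_gt0 Q0.
have := weak_cycle_bound pr_p k_ge3 hc disj' Q'0; rewrite cQ' predicted_cycles_power // -/b.
set Br := INR _.+1; have Br1 : 1 <= Br by apply: (le_INR 1); apply/leP.
have rp : 0 < INR r by apply: (lt_INR 0); apply/ltP.
have Br_le : ln Br <= ln B + ln (INR r).
  have : Br <= B * INR r.
    rewrite -mult_INR; apply: INR_leq.
    have -> : (p * (r * n) * k = p * n * k * r)%N by lia.
    by rewrite multE mulSn -addn1 addnC leq_add2r.
  rewrite -ln_mult //; last lra.
  by case/Rle_lt_or_eq_dec => [lt|->]; [left; apply: ln_increasing; lra | lra].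
rewrite lossE // => le.
have le' : b ^ r <= T ^ r * exp (C + E * ln Br).
  apply: (Rle_trans _ _ _ le); apply: Rmult_le_compat_r; first by left; exact: exp_pos.
  by rewrite -INR_expn; apply: INR_leq; exact: num_cycles_power.
have : ln (b ^ r) <= ln (T ^ r * exp (C + E * ln Br)).
  case: (Rle_lt_or_eq_dec _ _ le') => [lt|->]; last lra.
  by left; apply: ln_increasing => //; apply: pow_lt.
rewrite ln_mult; [|exact: pow_lt|exact: exp_pos].
rewrite !ln_pow // ln_exp.
have : E * ln Br <= E * (ln B + ln (INR r)) by exact: Rmult_le_compat_l.
lra.
Qed.

End CycleBound.

(** * Maximal disjoint families and the removal theorem *)

Lemma exists_maximal_disjoint_cycles (p n k : nat) (X : 'I_k -> {set 'rV['F_p]_n}) :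
  0 < k -> exists2 Q, disjoint_cycles X Q &
    forall f, f \in cycles X -> exists j, exists2 g, g \in Q & f j = g j.
Proof.
move=> k0; pose P (Q : {set {ffun 'I_k -> 'rV['F_p]_n}}) := (Q \subset cycles X) &&
  [forall f in Q, forall g in Q, forall j, (f j == g j) ==> (f == g)].
have [Q maxQ _] : {Q | maxset P Q & set0 \subset Q}.
  apply: maxset_exists; rewrite /P sub0set; apply/forall_inP => f; by rewrite inE.
have [/andP[subQ /forall_inP disj] max] := maxsetP maxQ.
have disjQ f g j : f \in Q -> g \in Q -> f j = g j -> f = g.
  move=> fQ gQ e; have /forall_inP/(_ _ gQ)/forallP/(_ j)/implyP h := disj f fQ.
  by apply/eqP/h/eqP.
exists Q => [|f fX]; first by [].
case: (boolP [exists j, exists g in Q, f j == g j]) => [/existsP[j /exists_inP[g gQ /eqP e]]|].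
  by exists j, g.
move=> /existsPn no; have ne j g : g \in Q -> f j != g j.
  move=> gQ; have := no j; rewrite negb_exists => /forallP/(_ g).
  by rewrite gQ.
(* A cycle avoiding [Q] can be adjoined, so by maximality it already lies in [Q]; but then it agrees
   with itself at coordinate 0, against [ne]. *)
have fQ : f \in Q.
  rewrite -(max (f |: Q)) ?setU11 ?subsetUr // /P subUset sub1set fX subQ /=.
  apply/forall_inP => g1 g1Q; apply/forall_inP => g2 g2Q; apply/forallP => j.
  apply/implyP => /eqP e; apply/eqP; move: g1Q g2Q; rewrite !in_setU1.
  case/orP => [/eqP e1|g1Q]; case/orP => [/eqP e2|g2Q].
  - by rewrite e1 e2.
  - by have := ne j _ g2Q; rewrite -e1 e eqxx.
  - by have := ne j _ g1Q; rewrite -e2 e eqxx.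
  - exact: disjQ e.
by have := ne (Ordinal k0) f fQ; rewrite eqxx.
Qed.

(* [%R] denotes the ring scope above this line and Stdlib's real scope below. *)
Delimit Scope R_scope with R.

Theorem theorem3 (p k : nat) (c eps : R) :
  prime p -> (3 <= k)%N -> is_c_p3 p c -> (0 < eps < 1)%R ->
  forall (n : nat), (1 <= n)%N ->
  forall X : 'I_k -> {set 'rV['F_p]_n},
    (Rpower eps (C_pk c k) * INR (expn p n) ^ (k - 1) <= INR (num_cycles X))%R
    \/
    (exists Y : 'I_k -> {set 'rV['F_p]_n},
        (forall i, Y i \subset X i) /\
        (forall i, (INR #|X i :\: Y i| < eps * INR (expn p n))%R) /\
        num_cycles Y = 0%N).
Proof.
move=> pr_p k3 hc eps01 n _ X.
have k0 : 0 < k by apply: leq_trans k3.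
have [Q disj maxQ] := exists_maximal_disjoint_cycles X k0.
set N := INR (expn p n).
have p0 : (0 < INR p)%R by apply: (lt_INR 0); apply/ltP/prime_gt0.
have N0 : (0 < N)%R by rewrite /N INR_expn; apply: pow_lt.
case: (Rlt_le_dec (INR #|Q|) (eps * N)) => [lt|le]; [right|left].
  exists (fun j => X j :\: [set (g : {ffun 'I_k -> _}) j | g in Q]); split; [|split].
  - by move=> j; rewrite subsetDl.
  - move=> j; apply: Rle_lt_trans lt; apply: INR_leq.
    rewrite setDDr setDv set0U; apply: leq_trans (leq_imset_card (fun g : {ffun 'I_k -> _} => g j) (mem Q)).
    by apply: subset_leq_card; rewrite subsetIr.
  apply/eqP; rewrite cards_eq0; apply/eqP/setP => f; rewrite in_set0.
  apply/negP => /cyclesP[h e].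
  have fX : f \in cycles X.
    by apply/cyclesP; split => // j; have := h j; rewrite inE => /andP[].
  have [j [g gQ eg]] := maxQ f fX.
  have /setDP[_ /imsetP[]] := h j.
  by exists g.
have Q0 : 0 < #|Q|.
  apply/ltP/INR_lt; apply: Rlt_le_trans le; rewrite /=; nra.
have c0 := c_p3_gt0 pr_p hc.
apply: Rle_trans (cycle_bound pr_p k3 hc disj Q0).
rewrite /predicted_cycles -/N; set m := INR #|Q| in le *.
have -> : (k - 1)%N = (k - 2).+1 by lia.
rewrite /C_pk Rpower_plus Rpower_1; last lra.
have -> : Rpower eps (INR (k - 2) / c) = (Rpower eps (/ c) ^ (k - 2))%R.
  rewrite -Rpower_pow; last exact: exp_pos.
  by rewrite Rpower_mult; congr Rpower; rewrite /Rdiv Rmult_comm.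
(* The exponent $1 + (k-2)/c$ is distributed so that [eps * N] faces [m], and each of the remaining
   $k-2$ factors faces $N (m/N)^{1/c}$. *)
have -> : (Rpower eps (/ c) ^ (k - 2) * eps * N ^ (k - 2).+1
    = eps * N * (N * Rpower eps (/ c)) ^ (k - 2))%R.
  by rewrite Rpow_mult_distr /=; ring.
have e0 : (0 < Rpower eps (/ c))%R by exact: exp_pos.
apply: Rmult_le_compat => //.
- by apply: Rmult_le_pos; lra.
- by apply: pow_le; apply: Rmult_le_pos; lra.
apply: pow_incr; split; first by apply: Rmult_le_pos; lra.
apply: Rmult_le_compat_l; first lra.
apply: Rle_Rpower_l; first by left; apply: Rinv_0_lt_compat.
split; first lra.
apply: (Rmult_le_reg_r N) => //.
have -> : (m / N * N = m)%R by field; lra.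
exact: le.
Qed.
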